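(* Let $\mathcal{C}$ be a category with pullbacks and $\mathbb{T}=(T,\eta,\mu)$ a monad on $\mathcal{C}$. In addition to pullbacks, let $\mathcal{C}$ have binary products and $\mathcal{J}$-indexed wide pullbacks, for some category $\mathcal{J}$. Then, for $\mathcal{A}$ any of the categories of the chain $$\mathsf{Ord}(\mathbb{T})\hookrightarrow\mathsf{Cat}(\mathbb{T})\longrightarrow\mathsf{Gph}_\bullet(\mathbb{T})\longrightarrow\mathsf{Gph}(\mathbb{T}),$$ the following hold. (1) The object functor $(-)_0:\mathcal{A}\to\mathcal{C}$ is $\mathcal{J}$-topological, has a right-adjoint right-inverse functor and, except for $\mathcal{A}=\mathsf{Gph}(\mathbb{T})$, also a left-adjoint right-inverse functor. (2) Every category of the chain has all $\mathcal{J}$-indexed limits if $\mathcal{C}$ has them, and they are preserved by its object functor $(-)_0$, as well as by the link of the chain departing from it (if any), which, in fact, preserves the $(-)_0$-cartesianness of $\mathcal{J}$-indexed cones. (3) Irrespective of whether $\mathcal{C}$ has binary products and $\mathcal{J}$-indexed wide pullbacks, also the Eilenberg–Moore category $\mathsf{Alg}(\mathbb{T})$ has all $\mathcal{J}$-indexed limits if $\mathcal{C}$ has them, and they are preserved by the full embedding $\mathsf{Alg}(\mathbb{T})\hookrightarrow\mathsf{Ord}(\mathbb{T})$.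
   Context: Composition is written $g\cdot f$ ($f$ first). A $\mathbb{T}$-graph $A=(A_0,A_1,d_0,c_0)$ is a pair of morphisms $d_0:A_1\to TA_0$, $c_0:A_1\to A_0$ in $\mathcal{C}$. A morphism $f=(f_0,f_1):A\to B$ of $\mathbb{T}$-graphs consists of $f_0:A_0\to B_0$, $f_1:A_1\to B_1$ with $d_0^B\cdot f_1=Tf_0\cdot d_0^A$ and $c_0^B\cdot f_1=f_0\cdot c_0^A$. These form the category $\mathsf{Gph}(\mathbb{T})$. A pointed $\mathbb{T}$-graph $(A,i)$ is a $\mathbb{T}$-graph $A$ with a morphism $i:A_0\to A_1$ such that $d_0\cdot i=\eta_{A_0}$ and $c_0\cdot i=1_{A_0}$. Morphisms of pointed $\mathbb{T}$-graphs are $\mathbb{T}$-graph morphisms $f$ with $f_1\cdot i^A=i^B\cdot f_0$. They form $\mathsf{Gph}_\bullet(\mathbb{T})$. For a pointed $\mathbb{T}$-graph $(A,i)$, let $A_2$ be the pullback of $Tc_0:TA_1\to TA_0$ and $d_0:A_1\to TA_0$, with projections $d_1:A_2\to TA_1$, $c_1:A_2\to A_1$ (so $Tc_0\cdot d_1=d_0\cdot c_1$), and let $A_3$ be the pullback of $Tc_1:TA_2\to TA_1$ and $d_1:A_2\to TA_1$, with projections $d_2:A_3\to TA_2$, $c_2:A_3\to A_2$ (so $Tc_1\cdot d_2=d_1\cdot c_2$). Morphisms $i_1,i_2:A_1\to A_2$ are determined by $d_1\cdot i_1=Ti\cdot d_0$, $c_1\cdot i_1=1_{A_1}$, $d_1\cdot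 i_2=\eta_{A_1}$, $c_1\cdot i_2=i\cdot c_0$. A $\mathbb{T}$-category $(A,i,m)$ is a pointed $\mathbb{T}$-graph $(A,i)$ with a morphism $m:A_2\to A_1$ such that $d_0\cdot m=\mu_{A_0}\cdot Td_0\cdot d_1$, $c_0\cdot m=c_0\cdot c_1$, $m\cdot i_1=1_{A_1}=m\cdot i_2$, and $m\cdot m_1=m\cdot m_2$, where $m_1,m_2:A_3\to A_2$ are determined by $d_1\cdot m_1=Tm\cdot d_2$, $c_1\cdot m_1=c_1\cdot c_2$, $d_1\cdot m_2=\mu_{A_1}\cdot Td_1\cdot d_2$, $c_1\cdot m_2=m\cdot c_2$. A $\mathbb{T}$-functor $f:A\to B$ is a morphism of pointed $\mathbb{T}$-graphs with $f_1\cdot m^A=m^B\cdot f_2$, where $f_2:A_2\to B_2$ is determined by $d_1^B\cdot f_2=Tf_1\cdot d_1^A$, $c_1^B\cdot f_2=f_1\cdot c_1^A$. $\mathbb{T}$-categories and $\mathbb{T}$-functors form $\mathsf{Cat}(\mathbb{T})$. A $\mathbb{T}$-category is ordered if the pair $(d_0,c_0)$ is jointly monic; $\mathsf{Ord}(\mathbb{T})$ is the full subcategory of $\mathsf{Cat}(\mathbb{T})$ of ordered $\mathbb{T}$-categories. The links of the chain are the full inclusion $\mathsf{Ord}(\mathbb{T})\hookrightarrow\mathsf{Cat}(\mathbb{T})$, the functor forgetting $m$, and the functor forgetting $i$. For each $\mathcal{A}$ in the chain, $(-)_0:\mathcal{A}\to\mathcal{C}$ sends $A\mapsto A_0$, $f\mapsto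 f_0$. The full embedding $\mathsf{Alg}(\mathbb{T})\hookrightarrow\mathsf{Ord}(\mathbb{T})$ sends a $\mathbb{T}$-algebra $(A,a:TA\to A)$ to the $\mathbb{T}$-graph $(A,TA,1_{TA},a)$ with $i=\eta_A$, $m=\mu_A$ (where $A_2\cong TTA$ via $d_1$), and a homomorphism $f$ to $(f,Tf)$. Topologicity. $\Delta X$ denotes the constant diagram with value $X$. For a functor $P:\mathcal{A}\to\mathcal{C}$, an object $X$ of $\mathcal{C}$ and a diagram $H:\mathcal{J}\to\mathcal{A}$, a natural transformation $\xi:\Delta X\to PH$ is a $\mathcal{J}$-indexed $P$-structured cone. A lifting of $\xi$ is a cone $\alpha:\Delta A\to H$ in $\mathcal{A}$ with $PA=X$ and $P\alpha=\xi$. A cone $\alpha:\Delta A\to H$ is $P$-cartesian if for every cone $\beta:\Delta B\to H$ in $\mathcal{A}$ and every morphism $g:PB\to PA$ in $\mathcal{C}$ with $P\alpha\cdot\Delta g=P\beta$ there is a unique morphism $f:B\to A$ in $\mathcal{A}$ with $\alpha\cdot\Delta f=\beta$ and $Pf=g$. $P$ is $\mathcal{J}$-topological if every $\mathcal{J}$-indexed $P$-structured cone has a $P$-cartesian lifting. Wide pullbacks. A wide pullback of a cocone $\beta:H\to\Delta B$, with $H:\mathcal{J}\to\mathcal{C}$, is a cone $\alpha:\Delta A\to H$ together with a morphism $p:A\to B$ such that $\beta\cdot\alpha=\Delta p$ and such that for every cone $\gamma:\Delta C\to H$ and morphism $q:C\to B$ with $\beta\cdot\gamma=\Delta q$ there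 is a unique $f:C\to A$ with $\gamma=\alpha\cdot\Delta f$ and $q=p\cdot f$. $\mathcal{C}$ has $\mathcal{J}$-indexed wide pullbacks if every $\mathcal{J}$-indexed cocone in $\mathcal{C}$ has a wide pullback. A right-adjoint (left-adjoint) right-inverse functor of $P$ is a right (left) adjoint $R$ of $P$ with $PR=\mathrm{Id}$. *)

(* Defs.v *)
From Stdlib Require Import ProofIrrelevance.

Set Implicit Arguments.
Unset Strict Implicit.
Unset Printing Implicit Defensive.

Record Category : Type := {
  Ob :> Type;
  Hom : Ob -> Ob -> Type;
  idm : forall X : Ob, Hom X X;
  comp : forall X Y Z : Ob, Hom Y Z -> Hom X Y -> Hom X Z;
  comp_id_l : forall (X Y : Ob) (f : Hom X Y), comp (idm Y) f = f;
  comp_id_r : forall (X Y : Ob) (f : Hom X Y), comp f (idm X) = f;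
  comp_assoc : forall (X Y Z W : Ob) (h : Hom Z W) (g : Hom Y Z) (f : Hom X Y),
    comp h (comp g f) = comp (comp h g) f
}.

Arguments Hom {c} _ _.
Arguments idm {c} X.
Arguments comp {c X Y Z} _ _.

Notation "g · f" := (comp g f) (at level 40, left associativity).

Record Functor (A B : Category) : Type := {
  fobj :> A -> B;
  fmap : forall X Y : A, Hom X Y -> Hom (fobj X) (fobj Y);
  fmap_id : forall X : A, fmap (idm X) = idm (fobj X);
  fmap_comp : forall (X Y Z : A) (g : Hom Y Z) (f : Hom X Y),
    fmap (g · f) = fmap g · fmap f
}.

Arguments fmap {A B} _ {X Y} _.

Definition idF (A : Category) : Functor A A :=
  {| fobj := fun X => X;
     fmap := fun X Y f => f;
     fmap_id := fun X => eq_refl;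
     fmap_comp := fun X Y Z g f => eq_refl |}.

Definition compF (A B C : Category) (G : Functor B C) (F : Functor A B) :
  Functor A C.
Proof.
refine {| fobj := fun X => G (F X);
          fmap := fun X Y f => fmap G (fmap F f) |}.
- intros X; now rewrite !fmap_id.
- intros X Y Z g f; now rewrite !fmap_comp.
Defined.

Record NatTrans (A B : Category) (F G : Functor A B) : Type := {
  nt :> forall X : A, Hom (F X) (G X);
  nt_nat : forall (X Y : A) (f : Hom X Y), nt Y · fmap F f = fmap G f · nt X
}.

Record Adjunction (A B : Category) (F : Functor A B) (G : Functor B A) : Type := {
  adj_unit : NatTrans (idF A) (compF G F);
  adj_counit : NatTrans (compF F G) (idF B);
  adj_triangle_l : forall X : A,
    adj_counit (F X) · fmap F (adj_unit X) = idm (F X);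
  adj_triangle_r : forall Y : B,
    fmap G (adj_counit Y) · adj_unit (G Y) = idm (G Y)
}.

Definition has_right_adjoint_right_inverse (A C : Category) (P : Functor A C) : Prop :=
  exists R : Functor C A, inhabited (Adjunction P R) /\ compF P R = idF C.

Definition has_left_adjoint_right_inverse (A C : Category) (P : Functor A C) : Prop :=
  exists L : Functor C A, inhabited (Adjunction L P) /\ compF P L = idF C.

(* A cone is a natural transformation from the constant diagram at [X] to [H];
   a cocone is one from [H] to the constant diagram at [B]. *)
Record Cone (J A : Category) (H : Functor J A) (X : A) : Type := {
  leg :> forall j : J, Hom X (H j);
  leg_nat : forall (i j : J) (u : Hom i j), fmap H u · leg i = leg j
}.

Record Cocone (J A : Category) (H : Functor J A) (B : A) : Type := {
  coleg :> forall j : J, Hom (H j) B;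
  coleg_nat : forall (i j : J) (u : Hom i j), coleg j · fmap H u = coleg i
}.

Definition fmap_cone (J A B : Category) (F : Functor A B) (H : Functor J A)
  (X : A) (alpha : Cone H X) : Cone (compF F H) (F X).
Proof.
refine {| leg := fun j => fmap F (alpha j) : Hom (F X) (compF F H j) |}.
intros i j u; simpl; now rewrite <- fmap_comp, leg_nat.
Defined.

Definition is_limit (J A : Category) (H : Functor J A) (X : A)
  (alpha : Cone H X) : Prop :=
  forall (Y : A) (beta : Cone H Y),
    exists! f : Hom Y X, forall j : J, alpha j · f = beta j.

Definition has_limits (J A : Category) : Prop :=
  forall H : Functor J A, exists (X : A) (alpha : Cone H X), is_limit alpha.

Definition preserves_limits (J A B : Category) (F : Functor A B) : Prop :=
  forall (H : Functor J A) (X : A) (alpha : Cone H X),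
    is_limit alpha -> is_limit (fmap_cone F alpha).

(* [P A = X] is equality of objects, so [P alpha = xi] is stated after
   transporting the legs of [P alpha] along it. *)
Definition is_lifting (J A C : Category) (P : Functor A C) (H : Functor J A)
  (X : C) (xi : Cone (compF P H) X) (Y : A) (alpha : Cone H Y) : Prop :=
  exists e : P Y = X, forall j : J,
    eq_rect (P Y) (fun Z : C => Hom Z (P (H j))) (fmap P (alpha j)) X e = xi j.

Definition is_cartesian (J A C : Category) (P : Functor A C) (H : Functor J A)
  (Y : A) (alpha : Cone H Y) : Prop :=
  forall (B : A) (beta : Cone H B) (g : Hom (P B) (P Y)),
    (forall j : J, fmap P (alpha j) · g = fmap P (beta j)) ->
    exists! f : Hom B Y, (forall j : J, alpha j · f = beta j) /\ fmap P f = g.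

Definition topological (J A C : Category) (P : Functor A C) : Prop :=
  forall (H : Functor J A) (X : C) (xi : Cone (compF P H) X),
    exists (Y : A) (alpha : Cone H Y), is_lifting xi alpha /\ is_cartesian P alpha.

Definition preserves_cartesian (J A B C : Category) (P : Functor A C)
  (Q : Functor B C) (F : Functor A B) : Prop :=
  forall (H : Functor J A) (Y : A) (alpha : Cone H Y),
    is_cartesian P alpha -> is_cartesian Q (fmap_cone F alpha).

Record Pullback (C : Category) (X Y Z : C) (f : Hom X Z) (g : Hom Y Z) : Type := {
  pb_ob : C;
  pb_fst : Hom pb_ob X;
  pb_snd : Hom pb_ob Y;
  pb_comm : f · pb_fst = g · pb_snd;
  pb_lift : forall (W : C) (a : Hom W X) (b : Hom W Y), f · a = g · b -> Hom W pb_ob;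
  pb_lift_fst : forall (W : C) (a : Hom W X) (b : Hom W Y) (e : f · a = g · b),
    pb_fst · pb_lift e = a;
  pb_lift_snd : forall (W : C) (a : Hom W X) (b : Hom W Y) (e : f · a = g · b),
    pb_snd · pb_lift e = b;
  pb_unique : forall (W : C) (u v : Hom W pb_ob),
    pb_fst · u = pb_fst · v -> pb_snd · u = pb_snd · v -> u = v
}.

(* A choice of pullbacks: it fixes the objects [A2] and [A3] below. *)
Definition Pullbacks (C : Category) : Type :=
  forall (X Y Z : C) (f : Hom X Z) (g : Hom Y Z), Pullback f g.

Definition has_binary_products (C : Category) : Prop :=
  forall X Y : C, exists (P : C) (p : Hom P X) (q : Hom P Y),
    forall (W : C) (a : Hom W X) (b : Hom W Y),
      exists! u : Hom W P, p · u = a /\ q · u = b.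

Definition is_wide_pullback (J C : Category) (H : Functor J C) (B : C)
  (beta : Cocone H B) (A : C) (alpha : Cone H A) (p : Hom A B) : Prop :=
  (forall j : J, beta j · alpha j = p) /\
  forall (D : C) (gamma : Cone H D) (q : Hom D B),
    (forall j : J, beta j · gamma j = q) ->
    exists! f : Hom D A, (forall j : J, gamma j = alpha j · f) /\ q = p · f.

Definition has_wide_pullbacks (J C : Category) : Prop :=
  forall (H : Functor J C) (B : C) (beta : Cocone H B),
    exists (A : C) (alpha : Cone H A) (p : Hom A B), is_wide_pullback beta alpha p.

Record Monad (C : Category) : Type := {
  mfun :> Functor C C;
  eta : forall X : C, Hom X (mfun X);
  mu : forall X : C, Hom (mfun (mfun X)) (mfun X);
  eta_nat : forall (X Y : C) (f : Hom X Y), eta Y · f = fmap mfun f · eta X;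
  mu_nat : forall (X Y : C) (f : Hom X Y),
    mu Y · fmap mfun (fmap mfun f) = fmap mfun f · mu X;
  monad_id_l : forall X : C, mu X · fmap mfun (eta X) = idm (mfun X);
  monad_id_r : forall X : C, mu X · eta (mfun X) = idm (mfun X);
  monad_assoc : forall X : C, mu X · fmap mfun (mu X) = mu X · mu (mfun X)
}.

Section FullSubcategory.
Variables (A : Category) (S : A -> Prop).

Definition full_sub : Category :=
  {| Ob := {X : A | S X};
     Hom := fun X Y => Hom (proj1_sig X) (proj1_sig Y);
     idm := fun X => idm (proj1_sig X);
     comp := fun X Y Z g f => g · f;
     comp_id_l := fun X Y f => comp_id_l f;
     comp_id_r := fun X Y f => comp_id_r f;
     comp_assoc := fun X Y Z W h g f => comp_assoc h g f |}.

Definition full_sub_incl : Functor full_sub A :=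
  {| fobj := fun X : full_sub => proj1_sig X;
     fmap := fun X Y f => f;
     fmap_id := fun X => eq_refl;
     fmap_comp := fun X Y Z g f => eq_refl |}.
End FullSubcategory.

Section Graphs.
Variables (C : Category) (T : Monad C).

Record graph : Type := {
  A0 : C;
  A1 : C;
  d0 : Hom A1 (T A0);
  c0 : Hom A1 A0
}.

Record graph_hom (A B : graph) : Type := {
  gf0 : Hom (A0 A) (A0 B);
  gf1 : Hom (A1 A) (A1 B);
  gf_d0 : d0 B · gf1 = fmap T gf0 · d0 A;
  gf_c0 : c0 B · gf1 = gf0 · c0 A
}.

Lemma graph_hom_eq (A B : graph) (f g : graph_hom A B) :
  gf0 f = gf0 g -> gf1 f = gf1 g -> f = g.
Proof.
destruct f, g; simpl; intros -> ->; f_equal; apply proof_irrelevance.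
Qed.

Definition graph_id (A : graph) : graph_hom A A.
Proof.
refine {| gf0 := idm (A0 A); gf1 := idm (A1 A) |}.
- now rewrite fmap_id, comp_id_l, comp_id_r.
- now rewrite comp_id_l, comp_id_r.
Defined.

Definition graph_comp (A B D : graph) (g : graph_hom B D) (f : graph_hom A B) :
  graph_hom A D.
Proof.
refine {| gf0 := gf0 g · gf0 f; gf1 := gf1 g · gf1 f |}.
- now rewrite comp_assoc, gf_d0, <- comp_assoc, gf_d0, comp_assoc, fmap_comp.
- now rewrite comp_assoc, gf_c0, <- comp_assoc, gf_c0, comp_assoc.
Defined.

Definition Gph : Category.
Proof.
refine {| Ob := graph; Hom := graph_hom; idm := graph_id; comp := graph_comp |}.
- intros; apply graph_hom_eq; apply comp_id_l.
- intros; apply graph_hom_eq; apply comp_id_r.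
- intros; apply graph_hom_eq; apply comp_assoc.
Defined.

Definition Gph_ob : Functor Gph C :=
  {| fobj := fun A : Gph => A0 A;
     fmap := fun (A B : Gph) (f : Hom A B) => gf0 f;
     fmap_id := fun A => eq_refl;
     fmap_comp := fun A B D g f => eq_refl |}.

Record pgraph : Type := {
  pg :> graph;
  pt : Hom (A0 pg) (A1 pg);
  pt_d0 : d0 pg · pt = eta T (A0 pg);
  pt_c0 : c0 pg · pt = idm (A0 pg)
}.

Record pgraph_hom (A B : pgraph) : Type := {
  pf :> graph_hom A B;
  pf_pt : gf1 pf · pt A = pt B · gf0 pf
}.

Lemma pgraph_hom_eq (A B : pgraph) (f g : pgraph_hom A B) :
  pf f = pf g -> f = g.
Proof.
destruct f, g; simpl; intros ->; f_equal; apply proof_irrelevance.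
Qed.

Definition pgraph_id (A : pgraph) : pgraph_hom A A.
Proof.
refine {| pf := graph_id A |}.
simpl; now rewrite comp_id_l, comp_id_r.
Defined.

Definition pgraph_comp (A B D : pgraph) (g : pgraph_hom B D) (f : pgraph_hom A B) :
  pgraph_hom A D.
Proof.
refine {| pf := graph_comp g f |}.
simpl; now rewrite <- comp_assoc, pf_pt, comp_assoc, pf_pt, comp_assoc.
Defined.

Definition PGph : Category.
Proof.
refine {| Ob := pgraph; Hom := pgraph_hom; idm := pgraph_id; comp := pgraph_comp |}.
- intros; apply pgraph_hom_eq; exact (comp_id_l (c := Gph) _).
- intros; apply pgraph_hom_eq; exact (comp_id_r (c := Gph) _).
- intros; apply pgraph_hom_eq; exact (comp_assoc (c := Gph) _ _ _).
Defined.

Definition PGph_to_Gph : Functor PGph Gph :=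
  {| fobj := fun A : PGph => pg A : Gph;
     fmap := fun (A B : PGph) (f : Hom A B) => pf f : @Hom Gph (pg A) (pg B);
     fmap_id := fun A => eq_refl;
     fmap_comp := fun A B D g f => eq_refl |}.

End Graphs.

Section TCategories.
Variables (C : Category) (PB : Pullbacks C) (T : Monad C).

Definition A2_pb (A : graph T) := PB (fmap T (c0 A)) (d0 A).
Definition A2 (A : graph T) : C := pb_ob (A2_pb A).
Definition d1 (A : graph T) : Hom (A2 A) (T (A1 A)) := pb_fst (A2_pb A).
Definition c1 (A : graph T) : Hom (A2 A) (A1 A) := pb_snd (A2_pb A).

Lemma A2_comm (A : graph T) : fmap T (c0 A) · d1 A = d0 A · c1 A.
Proof. apply pb_comm. Qed.

Lemma A2_unique (A : graph T) (W : C) (u v : Hom W (A2 A)) :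
  d1 A · u = d1 A · v -> c1 A · u = c1 A · v -> u = v.
Proof. apply pb_unique. Qed.

Definition A3_pb (A : graph T) := PB (fmap T (c1 A)) (d1 A).
Definition A3 (A : graph T) : C := pb_ob (A3_pb A).
Definition d2 (A : graph T) : Hom (A3 A) (T (A2 A)) := pb_fst (A3_pb A).
Definition c2 (A : graph T) : Hom (A3 A) (A2 A) := pb_snd (A3_pb A).

Lemma A3_comm (A : graph T) : fmap T (c1 A) · d2 A = d1 A · c2 A.
Proof. apply pb_comm. Qed.

Lemma i1_compat (A : pgraph T) :
  fmap T (c0 A) · (fmap T (pt A) · d0 A) = d0 A · idm (A1 A).
Proof.
now rewrite comp_assoc, <- fmap_comp, pt_c0, fmap_id, comp_id_l, comp_id_r.
Qed.

Definition i1 (A : pgraph T) : Hom (A1 A) (A2 A) :=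
  pb_lift (A2_pb A) (i1_compat A).

Lemma d1_i1 (A : pgraph T) : d1 A · i1 A = fmap T (pt A) · d0 A.
Proof. apply (pb_lift_fst (A2_pb A)). Qed.

Lemma c1_i1 (A : pgraph T) : c1 A · i1 A = idm (A1 A).
Proof. apply (pb_lift_snd (A2_pb A)). Qed.

Lemma i2_compat (A : pgraph T) :
  fmap T (c0 A) · eta T (A1 A) = d0 A · (pt A · c0 A).
Proof.
now rewrite comp_assoc, pt_d0, eta_nat.
Qed.

Definition i2 (A : pgraph T) : Hom (A1 A) (A2 A) :=
  pb_lift (A2_pb A) (i2_compat A).

Lemma d1_i2 (A : pgraph T) : d1 A · i2 A = eta T (A1 A).
Proof. apply (pb_lift_fst (A2_pb A)). Qed.

Lemma c1_i2 (A : pgraph T) : c1 A · i2 A = pt A · c0 A.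
Proof. apply (pb_lift_snd (A2_pb A)). Qed.

Section Multiplication.
Variables (A : graph T) (m : Hom (A2 A) (A1 A)).
Hypothesis m_dom : d0 A · m = mu T (A0 A) · fmap T (d0 A) · d1 A.
Hypothesis m_cod : c0 A · m = c0 A · c1 A.

Lemma m1_compat :
  fmap T (c0 A) · (fmap T m · d2 A) = d0 A · (c1 A · c2 A).
Proof.
rewrite comp_assoc, <- fmap_comp, m_cod, fmap_comp, <- comp_assoc, A3_comm.
now rewrite !comp_assoc, A2_comm.
Qed.

Definition m1 : Hom (A3 A) (A2 A) := pb_lift (A2_pb A) m1_compat.

Lemma d1_m1 : d1 A · m1 = fmap T m · d2 A.
Proof. apply (pb_lift_fst (A2_pb A)). Qed.

Lemma c1_m1 : c1 A · m1 = c1 A · c2 A.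
Proof. apply (pb_lift_snd (A2_pb A)). Qed.

Lemma m2_compat :
  fmap T (c0 A) · (mu T (A1 A) · fmap T (d1 A) · d2 A) = d0 A · (m · c2 A).
Proof.
rewrite (comp_assoc (d0 A)), m_dom, <- (comp_assoc _ (d1 A) (c2 A)), <- A3_comm.
rewrite !comp_assoc, <- mu_nat, <- !(comp_assoc (mu T (A0 A))), <- !fmap_comp.
now rewrite A2_comm.
Qed.

Definition m2 : Hom (A3 A) (A2 A) := pb_lift (A2_pb A) m2_compat.

Lemma d1_m2 : d1 A · m2 = mu T (A1 A) · fmap T (d1 A) · d2 A.
Proof. apply (pb_lift_fst (A2_pb A)). Qed.

Lemma c1_m2 : c1 A · m2 = m · c2 A.
Proof. apply (pb_lift_snd (A2_pb A)). Qed.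
End Multiplication.

Record tcat : Type := {
  tc_pg :> pgraph T;
  m : Hom (A2 tc_pg) (A1 tc_pg);
  m_dom : d0 tc_pg · m = mu T (A0 tc_pg) · fmap T (d0 tc_pg) · d1 tc_pg;
  m_cod : c0 tc_pg · m = c0 tc_pg · c1 tc_pg;
  m_i1 : m · i1 tc_pg = idm (A1 tc_pg);
  m_i2 : m · i2 tc_pg = idm (A1 tc_pg);
  m_assoc : m · m1 m_cod = m · m2 m_dom
}.

Lemma f2_compat (A B : graph T) (f : graph_hom A B) :
  fmap T (c0 B) · (fmap T (gf1 f) · d1 A) = d0 B · (gf1 f · c1 A).
Proof.
rewrite !comp_assoc, <- fmap_comp, gf_c0, gf_d0, fmap_comp.
now rewrite <- !comp_assoc, A2_comm.
Qed.

Definition f2 (A B : graph T) (f : graph_hom A B) : Hom (A2 A) (A2 B) :=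
  pb_lift (A2_pb B) (f2_compat f).

Lemma d1_f2 (A B : graph T) (f : graph_hom A B) :
  d1 B · f2 f = fmap T (gf1 f) · d1 A.
Proof. apply (pb_lift_fst (A2_pb B)). Qed.

Lemma c1_f2 (A B : graph T) (f : graph_hom A B) :
  c1 B · f2 f = gf1 f · c1 A.
Proof. apply (pb_lift_snd (A2_pb B)). Qed.

Lemma f2_id (A : graph T) : f2 (graph_id A) = idm (A2 A).
Proof.
apply A2_unique.
- now rewrite d1_f2; simpl; rewrite fmap_id, comp_id_l, comp_id_r.
- now rewrite c1_f2; simpl; rewrite comp_id_l, comp_id_r.
Qed.

Lemma f2_comp (A B D : graph T) (g : graph_hom B D) (f : graph_hom A B) :
  f2 (graph_comp g f) = f2 g · f2 f.
Proof.
apply A2_unique.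
- rewrite (comp_assoc (d1 D)), !d1_f2, <- comp_assoc, d1_f2; simpl.
  now rewrite fmap_comp, comp_assoc.
- rewrite (comp_assoc (c1 D)), !c1_f2, <- comp_assoc, c1_f2; simpl.
  now rewrite comp_assoc.
Qed.

Record tfunctor (A B : tcat) : Type := {
  tf :> pgraph_hom A B;
  tf_m : gf1 tf · m A = m B · f2 tf
}.

Lemma tfunctor_eq (A B : tcat) (f g : tfunctor A B) : tf f = tf g -> f = g.
Proof.
destruct f, g; simpl; intros ->; f_equal; apply proof_irrelevance.
Qed.

Definition tfunctor_id (A : tcat) : tfunctor A A.
Proof.
refine {| tf := pgraph_id A |}.
simpl; now rewrite f2_id, comp_id_l, comp_id_r.
Defined.

Definition tfunctor_comp (A B D : tcat) (g : tfunctor B D) (f : tfunctor A B) :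
  tfunctor A D.
Proof.
refine {| tf := pgraph_comp g f |}.
simpl; now rewrite f2_comp, <- comp_assoc, tf_m, comp_assoc, tf_m, comp_assoc.
Defined.

Definition Cat : Category.
Proof.
refine {| Ob := tcat; Hom := tfunctor; idm := tfunctor_id; comp := tfunctor_comp |}.
- intros; apply tfunctor_eq; exact (comp_id_l (c := PGph T) _).
- intros; apply tfunctor_eq; exact (comp_id_r (c := PGph T) _).
- intros; apply tfunctor_eq; exact (comp_assoc (c := PGph T) _ _ _).
Defined.

Definition Cat_to_PGph : Functor Cat (PGph T) :=
  {| fobj := fun A : Cat => tc_pg A : PGph T;
     fmap := fun (A B : Cat) (f : Hom A B) => tf f : @Hom (PGph T) (tc_pg A) (tc_pg B);
     fmap_id := fun A => eq_refl;
     fmap_comp := fun A B D g f => eq_refl |}.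

Definition is_ordered (A : Cat) : Prop :=
  forall (W : C) (u v : Hom W (A1 A)),
    d0 A · u = d0 A · v -> c0 A · u = c0 A · v -> u = v.

Definition Ord : Category := full_sub is_ordered.

Definition Ord_to_Cat : Functor Ord Cat := full_sub_incl is_ordered.

Inductive chain : Type := ORD | CAT | PGPH | GPH.

Definition chain_cat (k : chain) : Category :=
  match k with
  | ORD => Ord
  | CAT => Cat
  | PGPH => PGph T
  | GPH => Gph T
  end.

Definition PGph_ob : Functor (PGph T) C := compF (Gph_ob T) (PGph_to_Gph T).
Definition Cat_ob : Functor Cat C := compF PGph_ob Cat_to_PGph.
Definition Ord_ob : Functor Ord C := compF Cat_ob Ord_to_Cat.

Definition chain_ob (k : chain) : Functor (chain_cat k) C :=
  match k with
  | ORD => Ord_ob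
  | CAT => Cat_ob
  | PGPH => PGph_ob
  | GPH => Gph_ob T
  end.

End TCategories.

Section Algebras.
Variables (C : Category) (PB : Pullbacks C) (T : Monad C).

Record algebra : Type := {
  car : C;
  act : Hom (T car) car;
  act_eta : act · eta T car = idm car;
  act_mu : act · fmap T act = act · mu T car
}.

Record algebra_hom (A B : algebra) : Type := {
  af :> Hom (car A) (car B);
  af_act : af · act A = act B · fmap T af
}.

Lemma algebra_hom_eq (A B : algebra) (f g : algebra_hom A B) :
  af f = af g -> f = g.
Proof.
destruct f, g; simpl; intros ->; f_equal; apply proof_irrelevance.
Qed.

Definition algebra_id (A : algebra) : algebra_hom A A.
Proof.
refine {| af := idm (car A) |}.
now rewrite fmap_id, comp_id_l, comp_id_r.
Defined.

Definition algebra_comp (A B D : algebra) (g : algebra_hom B D)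
  (f : algebra_hom A B) : algebra_hom A D.
Proof.
refine {| af := af g · af f |}.
now rewrite <- comp_assoc, af_act, comp_assoc, af_act, fmap_comp, comp_assoc.
Defined.

Definition Alg : Category.
Proof.
refine {| Ob := algebra; Hom := algebra_hom; idm := algebra_id; comp := algebra_comp |}.
- intros; apply algebra_hom_eq; apply comp_id_l.
- intros; apply algebra_hom_eq; apply comp_id_r.
- intros; apply algebra_hom_eq; apply comp_assoc.
Defined.

Definition alg_graph (A : algebra) : graph T :=
  {| A0 := car A; A1 := T (car A); d0 := idm (T (car A)); c0 := act A |}.

Definition alg_pgraph (A : algebra) : pgraph T.
Proof.
refine {| pg := alg_graph A; pt := eta T (car A) |}.
- apply comp_id_l.
- apply act_eta.
Defined.

(* Here [d1] is invertible, being a pullback of the identity [d0], and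
   [mu · d1] is [mu] read through this isomorphism. *)
Definition alg_m (A : algebra) :
  Hom (A2 PB (alg_pgraph A)) (A1 (alg_pgraph A)) :=
  mu T (car A) · d1 PB (alg_graph A).

Lemma alg_m_dom (A : algebra) :
  d0 (alg_pgraph A) · alg_m A =
  mu T (A0 (alg_pgraph A)) · fmap T (d0 (alg_pgraph A)) · d1 PB (alg_pgraph A).
Proof. simpl; now rewrite fmap_id, comp_id_l, comp_id_r. Qed.

Lemma alg_m_cod (A : algebra) :
  c0 (alg_pgraph A) · alg_m A = c0 (alg_pgraph A) · c1 PB (alg_pgraph A).
Proof.
pose proof (A2_comm PB (alg_graph A)) as E; simpl in E.
unfold alg_m; simpl.
now rewrite comp_assoc, <- act_mu, <- comp_assoc, E, comp_id_l.
Qed.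

Lemma alg_m_i1 (A : algebra) :
  alg_m A · i1 PB (alg_pgraph A) = idm (A1 (alg_pgraph A)).
Proof.
pose proof (d1_i1 PB (alg_pgraph A)) as E; simpl in E.
unfold alg_m; simpl; rewrite <- comp_assoc, E.
now rewrite comp_id_r, monad_id_l.
Qed.

Lemma alg_m_i2 (A : algebra) :
  alg_m A · i2 PB (alg_pgraph A) = idm (A1 (alg_pgraph A)).
Proof.
pose proof (d1_i2 PB (alg_pgraph A)) as E; simpl in E.
unfold alg_m; simpl; rewrite <- comp_assoc, E.
apply monad_id_r.
Qed.

Lemma alg_m_assoc (A : algebra) :
  alg_m A · m1 (alg_m_cod A) = alg_m A · m2 (alg_m_dom A).
Proof.
pose proof (d1_m1 (alg_m_cod A)) as E1.
pose proof (d1_m2 (alg_m_dom A)) as E2.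
unfold alg_m at 1 3; simpl in E1, E2 |- *.
rewrite <- !comp_assoc, E1, E2; unfold alg_m.
now rewrite fmap_comp, !comp_assoc, monad_assoc.
Qed.

Definition alg_tcat (A : algebra) : tcat PB T :=
  {| tc_pg := alg_pgraph A;
     m := alg_m A;
     m_dom := alg_m_dom A;
     m_cod := alg_m_cod A;
     m_i1 := alg_m_i1 A;
     m_i2 := alg_m_i2 A;
     m_assoc := alg_m_assoc A |}.

Lemma alg_ordered (A : algebra) : is_ordered (alg_tcat A).
Proof.
intros W u v; simpl; rewrite !comp_id_l; auto.
Qed.

Arguments alg_ordered A : clear implicits.

Definition alg_graph_hom (A B : algebra) (f : algebra_hom A B) :
  graph_hom (alg_graph A) (alg_graph B).
Proof.
refine (Build_graph_hom (A := alg_graph A) (B := alg_graph B)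
          (gf0 := af f) (gf1 := fmap T (af f)) _ _); simpl.
- now rewrite comp_id_l, comp_id_r.
- symmetry; apply af_act.
Defined.

Definition alg_pgraph_hom (A B : algebra) (f : algebra_hom A B) :
  pgraph_hom (alg_pgraph A) (alg_pgraph B).
Proof.
refine (Build_pgraph_hom (A := alg_pgraph A) (B := alg_pgraph B)
          (pf := alg_graph_hom f) _); simpl.
symmetry; apply eta_nat.
Defined.

Definition alg_tfunctor (A B : algebra) (f : algebra_hom A B) :
  tfunctor (alg_tcat A) (alg_tcat B).
Proof.
refine (Build_tfunctor (A := alg_tcat A) (B := alg_tcat B)
          (tf := alg_pgraph_hom f) _); simpl.
pose proof (d1_f2 PB (alg_graph_hom f)) as E; simpl in E.
unfold alg_m; simpl; rewrite <- comp_assoc, E.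
now rewrite !comp_assoc, mu_nat.
Defined.

Definition Alg_to_Ord : Functor Alg (Ord PB T).
Proof.
refine {| fobj := fun A : Alg => exist _ (alg_tcat A) (alg_ordered A) : Ord PB T;
          fmap := fun (A B : Alg) (f : Hom A B) => alg_tfunctor f
            : @Hom (Ord PB T) (exist _ (alg_tcat A) (alg_ordered A))
                              (exist _ (alg_tcat B) (alg_ordered B)) |}.
- intros A; apply tfunctor_eq, pgraph_hom_eq, graph_hom_eq; simpl;
    [reflexivity | apply fmap_id].
- intros A B D g f; apply tfunctor_eq, pgraph_hom_eq, graph_hom_eq; simpl;
    [reflexivity | apply fmap_comp].
Defined.

End Algebras.

(* Main.v *)
From Stdlib Require Import ProofIrrelevance FunctionalExtensionality IndefiniteDescription.
Require Import Defs.

(** An edge object over a fixed object of vertices [X] is the same thing as an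
    object with a pair of maps to [T X] and [X], that is, an object over
    [T X x X].  Given graphs [H j] and vertex maps [X -> A0 (H j)], the edges of
    [H j] with both ends in [X] form such an object (the limit of a zigzag), and
    the wide pullback of all these objects over [T X x X] is the universal edge
    object of a graph on [X] mapping to every [H j].  So the object functor of
    graphs is topological ([Gph_topological]).

    Cartesianness of a graph cone says, for the edges of its vertex, that they
    are jointly detected by the ends and the legs ([cartesian_jointly_monic]),
    and that a map into them can be given by compatible ends and legs
    ([cartesian_factor]).  Hence units and multiplications of the graphs [H j]
    induce a unit and a multiplication on the vertex of the cone, and every
    axiom, as well as every compatibility of a comparison morphism, can be
    checked on ends and on legs, where it holds.  So each link of the chain lifts
    cartesian cones; for a cone over ordered T-categories this consists in noting
    that the pair of ends of the vertex is again jointly monic.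

    The rest is formal.  If a functor [Q] is topological and [F] lifts
    [Q]-cartesian cones to [QF]-cartesian ones, then [QF] is topological and,
    cartesian liftings being unique up to isomorphism, [F] preserves
    cartesianness ([topological_comp], [preserves_cartesian_comp]).  A limit in
    the domain of a topological functor is a cartesian lifting of a limit of the
    underlying diagram, so limits exist and are preserved, both by the
    topological functor and by each link.  A right adjoint right inverse is given
    by the cartesian liftings of empty cones, which exist because wide pullbacks
    of empty cocones always do; a left one by the discrete graphs, with
    [A1 = A0] and [d0 = eta].

    Limits of algebras are created by the underlying-object functor.  For an
    algebra [L], a T-functor [B -> L] is just a morphism [g] on vertices with
    [act L · T g · d0 = g · c0] ([hom_to_algebra], [hom_to_algebra_ext]), and
    this equation can be tested on the legs of a limit cone; so such cones
    remain limit cones among ordered T-categories. *)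

Set Implicit Arguments.
Unset Strict Implicit.
Unset Printing Implicit Defensive.

(** * Composition, isomorphisms and equality of functors *)

(** Lets an equation between composites be used under an arbitrary
    precomposition when everything is associated to the right. *)
Lemma whisker (C : Category) (X Y Z : C) (g : Hom Y Z) (f : Hom X Y) (k : Hom X Z) :
  g · f = k -> forall (W : C) (h : Hom W X), g · (f · h) = k · h.
Proof. intros <- W h; apply comp_assoc. Qed.

Ltac rassoc := rewrite <- ?comp_assoc.

Tactic Notation "rw" uconstr(E) :=
  rassoc; first [rewrite E | rewrite (whisker E)]; rassoc.

Definition inverse (C : Category) (X Y : C) (u : Hom X Y) (v : Hom Y X) : Prop :=
  v · u = idm X /\ u · v = idm Y.

Lemma fmap_inverse (A B : Category) (F : Functor A B) (X Y : A)
  (u : Hom X Y) (v : Hom Y X) : inverse u v -> inverse (fmap F u) (fmap F v).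
Proof.
intros [vu uv]; split; rewrite <- fmap_comp.
- now rewrite vu, fmap_id.
- now rewrite uv, fmap_id.
Qed.

(** The isomorphism given by an equality of objects; with it, transports of
    morphisms become ordinary composites. *)
Definition along (C : Category) (X Y : C) (e : X = Y) : Hom X Y :=
  eq_rect X (Hom X) (idm X) Y e.

Lemma along_inverse (C : Category) (X Y : C) (e : X = Y) :
  inverse (along e) (along (eq_sym e)).
Proof. destruct e; split; apply comp_id_l. Qed.

(** Strict equalities such as [compF P R = idF C] come from naturality of the
    isomorphisms [along]: once the object parts are identified, these are
    identities by uniqueness of equality proofs. *)
Lemma functor_ext (A B : Category) (F G : Functor A B) (e : forall X, F X = G X) :
  (forall (X Y : A) (f : Hom X Y), along (e Y) · fmap F f = fmap G f · along (e X)) ->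
  F = G.
Proof.
destruct F as [F0 F1 Fid Fcomp], G as [G0 G1 Gid Gcomp]; simpl in *.
assert (E : F0 = G0) by now apply functional_extensionality.
subst G0.
intros nat.
assert (E : F1 = G1).
{ extensionality X; extensionality Y; extensionality f.
  specialize (nat X Y f).
  rewrite (proof_irrelevance _ (e X) eq_refl), (proof_irrelevance _ (e Y) eq_refl) in nat.
  simpl in nat; now rewrite comp_id_l, comp_id_r in nat. }
subst G1; f_equal; apply proof_irrelevance.
Qed.

(** * Limits, liftings and cartesian cones *)

Section Limits.
Variables (J A : Category).

Lemma lifting_iso (C : Category) (P : Functor A C) (H : Functor J A) (X : C)
  (xi : Cone (compF P H) X) (Y : A) (alpha : Cone H Y) :
  is_lifting xi alpha ->
  exists (u : Hom (P Y) X) (v : Hom X (P Y)),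
    inverse u v /\ forall j, xi j · u = fmap P (alpha j).
Proof.
intros [e E]; exists (along e), (along (eq_sym e)); split.
- apply along_inverse.
- intros j; rewrite <- E; destruct e; apply comp_id_r.
Qed.

Lemma limit_of_iso (H : Functor J A) (X Y : A) (alpha : Cone H X) (beta : Cone H Y)
  (u : Hom X Y) (v : Hom Y X) :
  inverse u v -> (forall j, beta j · u = alpha j) -> is_limit beta -> is_limit alpha.
Proof.
intros [vu uv] E lim Z gamma.
destruct (lim Z gamma) as [f [Ef Uf]].
exists (v · f); split.
- intros j; rewrite <- E; rw uv; now rewrite comp_id_l.
- intros f' Ef'; rewrite (Uf (u · f')).
  + rw vu; apply comp_id_l.
  + intros j; rewrite comp_assoc, E; apply Ef'.
Qed.

Lemma limit_iso (H : Functor J A) (X Y : A) (alpha : Cone H X) (beta : Cone H Y) :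
  is_limit alpha -> is_limit beta ->
  exists (u : Hom X Y) (v : Hom Y X), inverse u v /\ forall j, beta j · u = alpha j.
Proof.
intros la lb.
destruct (lb X alpha) as [u [Eu _]], (la Y beta) as [v [Ev _]].
exists u, v; split; [split|exact Eu].
- destruct (la X alpha) as [w [_ Uw]].
  transitivity w; [symmetry|]; apply Uw; intros j.
  + rw (Ev j); apply Eu.
  + apply comp_id_r.
- destruct (lb Y beta) as [w [_ Uw]].
  transitivity w; [symmetry|]; apply Uw; intros j.
  + rw (Eu j); apply Ev.
  + apply comp_id_r.
Qed.

Lemma limit_jointly_monic (H : Functor J A) (X : A) (alpha : Cone H X) :
  is_limit alpha -> forall (W : A) (u v : Hom W X),
  (forall j, alpha j · u = alpha j · v) -> u = v.
Proof.
intros lim W u v E.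
assert (nat : forall (i j : J) (w : Hom i j), fmap H w · (alpha i · u) = alpha j · u)
  by (intros i j w; now rewrite comp_assoc, leg_nat).
destruct (lim W (Build_Cone (H := H) nat)) as [f [_ U]]; rewrite <- (U u), <- (U v); auto.
Qed.

End Limits.

Section CartesianCones.
Variables (J A C : Category) (P : Functor A C).

Lemma cartesian_of_iso (H : Functor J A) (X Y : A) (alpha : Cone H X) (beta : Cone H Y)
  (u : Hom X Y) (v : Hom Y X) :
  inverse u v -> (forall j, beta j · u = alpha j) ->
  is_cartesian P beta -> is_cartesian P alpha.
Proof.
intros [vu uv] E cart Z gamma g Eg.
destruct (cart Z gamma (fmap P u · g)) as [f [[Ef Pf] Uf]].
{ intros j; rewrite comp_assoc, <- fmap_comp, E; apply Eg. }
exists (v · f); split; [split|].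
- intros j; rewrite <- E; rw uv; now rewrite comp_id_l.
- now rewrite fmap_comp, Pf, comp_assoc, <- fmap_comp, vu, fmap_id, comp_id_l.
- intros f' [Ef' Pf']; rewrite (Uf (u · f')).
  + rw vu; apply comp_id_l.
  + split; [intros j; rewrite comp_assoc, E; apply Ef'|now rewrite fmap_comp, Pf'].
Qed.

Lemma cartesian_endo (H : Functor J A) (X : A) (alpha : Cone H X) (w : Hom X X) :
  is_cartesian P alpha -> (forall j, alpha j · w = alpha j) ->
  fmap P w = idm (P X) -> w = idm X.
Proof.
intros cart Ew Pw.
destruct (cart X alpha (idm (P X))) as [f [_ Uf]].
{ intros j; apply comp_id_r. }
transitivity f; [symmetry|]; apply Uf; split; auto.
- intros j; apply comp_id_r.
- apply fmap_id.
Qed.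

(** Cartesian liftings are unique up to isomorphism: the two comparison maps
    lie over [u] and [v], so their composites are endomorphisms over the
    identity that fix all legs. *)
Lemma cartesian_iso (H : Functor J A) (X Y : A) (alpha : Cone H X) (beta : Cone H Y)
  (u : Hom (P X) (P Y)) (v : Hom (P Y) (P X)) :
  inverse u v -> (forall j, fmap P (beta j) · u = fmap P (alpha j)) ->
  is_cartesian P alpha -> is_cartesian P beta ->
  exists (u' : Hom X Y) (v' : Hom Y X),
    inverse u' v' /\ forall j, beta j · u' = alpha j.
Proof.
intros [vu uv] E ca cb.
destruct (cb X alpha u E) as [u' [[Eu Pu] _]].
destruct (ca Y beta v) as [v' [[Ev Pv] _]].
{ intros j; rewrite <- E; rw uv; apply comp_id_r. }
exists u', v'; split; [split|exact Eu].
- apply (cartesian_endo ca).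
  + intros j; rw (Ev j); apply Eu.
  + now rewrite fmap_comp, Pu, Pv.
- apply (cartesian_endo cb).
  + intros j; rw (Eu j); apply Ev.
  + now rewrite fmap_comp, Pu, Pv.
Qed.

(** The limit determines the underlying morphism of a factorization, and
    cartesianness lifts it uniquely. *)
Lemma cartesian_over_limit (H : Functor J A) (Y : A) (alpha : Cone H Y) :
  is_cartesian P alpha -> is_limit (fmap_cone P alpha) -> is_limit alpha.
Proof.
intros cart lim Z gamma.
destruct (lim (P Z) (fmap_cone P gamma)) as [g [Eg Ug]]; simpl in Eg, Ug.
destruct (cart Z gamma g Eg) as [f [[Ef Pf] Uf]].
exists f; split; [exact Ef|].
intros f' Ef'; apply Uf; split; [exact Ef'|].
symmetry; apply Ug; intros j; now rewrite <- fmap_comp, Ef'.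
Qed.

Hypotheses (top : topological J P) (limC : has_limits J C).

(** The cartesian lifting of a limit of the underlying diagram carries all three
    properties at once; as limits are unique up to isomorphism, every limit
    then inherits them. *)
Lemma topological_limit (H : Functor J A) :
  exists (Y : A) (alpha : Cone H Y),
    is_limit alpha /\ is_cartesian P alpha /\ is_limit (fmap_cone P alpha).
Proof.
destruct (limC (compF P H)) as [X [xi lim]].
destruct (top xi) as [Y [alpha [lift cart]]].
exists Y, alpha.
destruct (lifting_iso lift) as [u [v [uv E]]].
assert (limP : is_limit (fmap_cone P alpha))
  by exact (limit_of_iso (alpha := fmap_cone P alpha) uv E lim).
split; [exact (cartesian_over_limit cart limP)|now split].
Qed.

Lemma topological_has_limits : has_limits J A.
Proof.
intros H; destruct (topological_limit H) as [Y [alpha [lim _]]]; now exists Y, alpha.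
Qed.

Lemma topological_preserves_limits : preserves_limits J P.
Proof.
intros H X alpha la.
destruct (topological_limit H) as [Y [beta [lb [_ lP]]]].
destruct (limit_iso la lb) as [u [v [uv E]]].
apply (limit_of_iso (beta := fmap_cone P beta) (fmap_inverse P uv)); [|exact lP].
intros j; simpl; now rewrite <- fmap_comp, E.
Qed.

Lemma limit_cartesian (H : Functor J A) (X : A) (alpha : Cone H X) :
  is_limit alpha -> is_cartesian P alpha.
Proof.
intros la.
destruct (topological_limit H) as [Y [beta [lb [cb _]]]].
destruct (limit_iso la lb) as [u [v [uv E]]].
exact (cartesian_of_iso uv E cb).
Qed.

End CartesianCones.

(** * Lifting cartesian cones along a functor *)

Section Links.
Variables (J A B C : Category) (Q : Functor B C) (F : Functor A B).

Definition lifts_cartesian : Prop :=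
  forall (H : Functor J A) (Y : B) (alpha : Cone (compF F H) Y),
    is_cartesian Q alpha ->
    exists (Y' : A) (alpha' : Cone H Y'),
      is_lifting alpha alpha' /\ is_cartesian (compF Q F) alpha'.

Hypotheses (top : topological J Q) (lifts : lifts_cartesian).

Lemma topological_comp : topological J (compF Q F).
Proof.
intros H X xi.
(* Only the proofs of functoriality differ between the two diagrams. *)
pose (xi' := Build_Cone (H := compF Q (compF F H)) (leg := fun j => xi j)
               (fun i j u => leg_nat xi u)).
destruct (top xi') as [Y [alpha [[e E] cart]]].
destruct (lifts cart) as [Y' [alpha' [[e' E'] cart']]].
exists Y', alpha'; split; [|exact cart'].
destruct e'; exists e; intros j; simpl in E'.
specialize (E j); rewrite <- E' in E; exact E.
Qed.

(** Lifting the underlying cone in two steps gives a cone with both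
    cartesianness properties over the same structured cone, hence isomorphic to
    the given one. *)
Lemma preserves_cartesian_comp : preserves_cartesian J (compF Q F) Q F.
Proof.
intros H X alpha cart.
destruct (top (fmap_cone Q (fmap_cone F alpha))) as [Y [beta [lift cartQ]]].
destruct (lifts cartQ) as [Y' [beta' [[e' E'] cart']]].
destruct e'; simpl in E'.
destruct (lifting_iso lift) as [u [v [[vu uv] E]]]; simpl in u, v, E.
destruct (@cartesian_iso J A C (compF Q F) H X Y' alpha beta' v u)
  as [u' [v' [uv' Ealpha]]]; auto.
- now split.
- intros j; simpl; rewrite (E' j), <- E; rw uv; apply comp_id_r.
- apply (cartesian_of_iso (beta := beta) (fmap_inverse F uv')); [|exact cartQ].
  intros j; simpl; rewrite <- E', <- fmap_comp; now rewrite Ealpha.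
Qed.

(** A limit in [A] is cartesian over a limit in [C]; [F] keeps the former and
    does not change the latter. *)
Lemma preserves_limits_link : has_limits J C -> preserves_limits J F.
Proof.
intros limC H X alpha la.
apply (cartesian_over_limit (P := Q)).
- apply preserves_cartesian_comp, limit_cartesian; auto; apply topological_comp.
- intros Z gamma.
  (* The two ways of associating the composite diagram agree only up to the
     proofs of functoriality, so the cone has to be rebuilt. *)
  pose (gamma' := Build_Cone (H := compF (compF Q F) H) (leg := fun j => gamma j)
                    (fun i j u => leg_nat gamma u)).
  exact (topological_preserves_limits topological_comp limC la gamma').
Qed.

End Links.

(** * Adjoint right inverses *)

Section Adjoints.
Variables (A C : Category) (P : Functor A C).

Definition empty_category : Category.
Proof.
refine {| Ob := Empty_set; Hom := fun _ _ => unit; idm := fun _ => tt;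
          comp := fun _ _ _ _ _ => tt |}; intros [].
Defined.

Definition empty_diagram (B : Category) : Functor empty_category B.
Proof.
refine {| fobj := fun X : empty_category => match X with end;
          fmap := fun X => match X with end |}; intros [].
Defined.

Definition empty_cone (B : Category) (H : Functor empty_category B) (X : B) : Cone H X.
Proof.
refine {| leg := fun j : empty_category => match j with end |}; intros [].
Defined.

Lemma choice (I : Type) (F : I -> Type) (R : forall i, F i -> Prop) :
  (forall i, exists y, R i y) -> exists f : forall i, F i, forall i, R i (f i).
Proof.
intros h; exists (fun i => proj1_sig (constructive_indefinite_description _ (h i))).
intros i; exact (proj2_sig (constructive_indefinite_description _ (h i))).
Qed.

(** When every morphism on underlying objects into [Y] lifts uniquely, [P] is
    bijective on morphisms into [Y], so choosing such a [Y] over each [X] leaves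
    one way to act on morphisms.  Unit and counit lie over the isomorphisms
    [along], and all laws hold because they hold after applying [P]. *)
Lemma indiscrete_right_adjoint :
  (forall X : C, exists (Y : A) (e : P Y = X), forall (B : A) (g : Hom (P B) (P Y)),
     exists! f : Hom B Y, fmap P f = g) ->
  has_right_adjoint_right_inverse P.
Proof.
intros h.
destruct (choice h) as [R hR]; destruct (choice hR) as [e hl].
assert (faithful : forall X (B : A) (f f' : Hom B (R X)), fmap P f = fmap P f' -> f = f').
{ intros X B f f' E; destruct (hl X B (fmap P f)) as [k [_ U]].
  rewrite <- (U f), <- (U f'); auto. }
assert (hlift : exists lift : forall (X : C) (B : A), Hom (P B) (P (R X)) -> Hom B (R X),
          forall X B g, fmap P (lift X B g) = g).
{ refine (choice (fun X => choice (fun B =>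
    choice (R := fun g f => fmap P f = g) (fun g => _)))).
  destruct (hl X B g) as [f [Pf _]]; now exists f. }
destruct hlift as [lift P_lift].
pose (k X := along (e X)); pose (k' X := along (eq_sym (e X))).
assert (k'k : forall X, k' X · k X = idm _) by (intros X; apply along_inverse).
assert (kk' : forall X, k X · k' X = idm _) by (intros X; apply along_inverse).
unshelve refine (let RF : Functor C A :=
  {| fobj := R;
     fmap := fun X X' f => lift X' (R X) (k' X' · f · k X) |} in _).
{ intros X; apply faithful; now rewrite P_lift, comp_id_r, k'k, fmap_id. }
{ intros X Y Z g f; apply faithful; rewrite fmap_comp, !P_lift.
  rw (kk' Y); now rewrite comp_id_l. }
exists RF; split.
- constructor.
  unshelve refine {| adj_unit := _; adj_counit := _ |}.
  + unshelve refine {| nt := fun B => lift (P B) B (k' (P B))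
                                  : Hom (idF A B) (compF RF P B) |}.
    intros X Y f; apply faithful; simpl; rewrite !fmap_comp, !P_lift.
    rw (kk' (P X)); now rewrite comp_id_r.
  + unshelve refine {| nt := fun X => k X : Hom (compF P RF X) (idF C X) |}.
    intros X Y f; simpl; rewrite P_lift; rw (kk' Y); apply comp_id_l.
  + intros X; simpl; rewrite P_lift; apply kk'.
  + intros Y; apply faithful; simpl; rewrite fmap_comp, !P_lift, fmap_id.
    rw (kk' (P (R Y))); rewrite comp_id_r; apply k'k.
- apply (functor_ext (F := compF P RF) (G := idF C) (e := e)).
  intros X Y f; simpl; rewrite P_lift; rw (kk' Y); apply comp_id_l.
Qed.

(** Dual to [indiscrete_right_adjoint], with morphisms out of [Y]. *)
Lemma discrete_left_adjoint :
  (forall X : C, exists (Y : A) (e : P Y = X), forall (B : A) (g : Hom (P Y) (P B)),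
     exists! f : Hom Y B, fmap P f = g) ->
  has_left_adjoint_right_inverse P.
Proof.
intros h.
destruct (choice h) as [L hL]; destruct (choice hL) as [e hl].
assert (faithful : forall X (B : A) (f f' : Hom (L X) B), fmap P f = fmap P f' -> f = f').
{ intros X B f f' E; destruct (hl X B (fmap P f)) as [k [_ U]].
  rewrite <- (U f), <- (U f'); auto. }
assert (hlift : exists lift : forall (X : C) (B : A), Hom (P (L X)) (P B) -> Hom (L X) B,
          forall X B g, fmap P (lift X B g) = g).
{ refine (choice (fun X => choice (fun B =>
    choice (R := fun g f => fmap P f = g) (fun g => _)))).
  destruct (hl X B g) as [f [Pf _]]; now exists f. }
destruct hlift as [lift P_lift].
pose (k X := along (e X)); pose (k' X := along (eq_sym (e X))).
assert (k'k : forall X, k' X · k X = idm _) by (intros X; apply along_inverse).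
assert (kk' : forall X, k X · k' X = idm _) by (intros X; apply along_inverse).
unshelve refine (let LF : Functor C A :=
  {| fobj := L;
     fmap := fun X X' f => lift X (L X') (k' X' · f · k X) |} in _).
{ intros X; apply faithful; now rewrite P_lift, comp_id_r, k'k, fmap_id. }
{ intros X Y Z g f; apply faithful; rewrite fmap_comp, !P_lift.
  rw (kk' Y); now rewrite comp_id_l. }
exists LF; split.
- constructor.
  unshelve refine {| adj_unit := _; adj_counit := _ |}.
  + unshelve refine {| nt := fun X => k' X : Hom (idF C X) (compF P LF X) |}.
    intros X Y f; simpl; rewrite P_lift; rw (kk' X); now rewrite comp_id_r.
  + unshelve refine {| nt := fun B => lift (P B) B (k (P B))
                                  : Hom (compF LF P B) (idF A B) |}.
    intros X Y f; apply faithful; simpl; rewrite !fmap_comp, !P_lift.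
    rw (kk' (P Y)); now rewrite comp_id_l.
  + intros X; apply faithful; simpl; rewrite fmap_comp, !P_lift, fmap_id.
    rw (kk' (P (L X))); rewrite comp_id_l; apply k'k.
  + intros Y; simpl; rewrite P_lift; apply kk'.
- apply (functor_ext (F := compF P LF) (G := idF C) (e := e)).
  intros X Y f; simpl; rewrite P_lift; rw (kk' Y); apply comp_id_l.
Qed.

(** For the empty cone, cartesianness is precisely unique lifting of morphisms
    into the vertex. *)
Lemma topological_right_adjoint :
  topological empty_category P -> has_right_adjoint_right_inverse P.
Proof.
intros top; apply indiscrete_right_adjoint; intros X.
destruct (top (empty_diagram A) X (empty_cone _ X)) as [Y [alpha [[e _] cart]]].
exists Y, e; intros B g.
destruct (cart B (empty_cone _ B) g) as [f [[_ Pf] Uf]]; [intros []|].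
exists f; split; [exact Pf|].
intros f' Pf'; apply Uf; split; [intros []|exact Pf'].
Qed.

End Adjoints.

(** * Graphs: the object functor is topological *)

Section Restriction.
Variables (C : Category) (PB : Pullbacks C) (T : Monad C).

Section RestrictedEdges.
Variables (A : graph T) (X : C) (x : Hom X (A0 A)).

(** The edges of [A] with both ends in [X]: the limit of the zigzag
    [T X -> T A0 <- A1 -> A0 <- X].  A single product [T X x X]
    then serves all graphs of a diagram. *)
Definition dom_pb := PB (fmap T x) (d0 A).
Definition cod_pb := PB (c0 A) x.
Definition edge_pb := PB (pb_snd dom_pb) (pb_fst cod_pb).

Definition rA1 : C := pb_ob edge_pb.
Definition rd0 : Hom rA1 (T X) := pb_fst dom_pb · pb_fst edge_pb.
Definition rc0 : Hom rA1 X := pb_snd cod_pb · pb_snd edge_pb.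
Definition redge : Hom rA1 (A1 A) := pb_snd dom_pb · pb_fst edge_pb.

Lemma redge_d0 : d0 A · redge = fmap T x · rd0.
Proof.
unfold redge, rd0; rewrite !comp_assoc; f_equal; symmetry; apply pb_comm.
Qed.

Lemma redge_c0 : c0 A · redge = x · rc0.
Proof.
unfold redge, rc0; rewrite (pb_comm edge_pb), !comp_assoc; f_equal; apply pb_comm.
Qed.

Lemma redge_lift (W : C) (d : Hom W (T X)) (c : Hom W X) (l : Hom W (A1 A)) :
  d0 A · l = fmap T x · d -> c0 A · l = x · c ->
  {u : Hom W rA1 | rd0 · u = d /\ rc0 · u = c /\ redge · u = l}.
Proof.
intros Ed Ec.
assert (E : pb_snd dom_pb · pb_lift dom_pb (eq_sym Ed)
            = pb_fst cod_pb · pb_lift cod_pb Ec)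
  by now rewrite pb_lift_snd, pb_lift_fst.
exists (pb_lift edge_pb E); unfold rd0, rc0, redge; rassoc.
rewrite pb_lift_fst, pb_lift_snd, !pb_lift_fst, !pb_lift_snd; auto.
Qed.

Lemma redge_unique (W : C) (u v : Hom W rA1) :
  rd0 · u = rd0 · v -> rc0 · u = rc0 · v -> redge · u = redge · v -> u = v.
Proof.
unfold rd0, rc0; intros Ed Ec El; pose proof El as El'; unfold redge in El.
rewrite <- !comp_assoc in *.
apply (pb_unique (p := edge_pb)); [apply (pb_unique (p := dom_pb)); auto|].
apply (pb_unique (p := cod_pb)); auto.
revert El'; unfold redge; now rewrite (pb_comm edge_pb), <- !comp_assoc.
Qed.
End RestrictedEdges.

Variables (J : Category) (H : Functor J (Gph T)) (X : C)
  (xi : Cone (compF (Gph_ob T) H) X).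

Let arrow (i j : J) (u : Hom i j) : graph_hom (H i) (H j) := fmap H u.

Lemma rmap_exists (i j : J) (u : Hom i j) :
  {f : Hom (rA1 (A := H i) (xi i)) (rA1 (A := H j) (xi j)) |
     rd0 (xi j) · f = rd0 (xi i) /\ rc0 (xi j) · f = rc0 (xi i) /\
     redge (xi j) · f = gf1 (arrow u) · redge (xi i)}.
Proof.
assert (Exi : gf0 (arrow u) · xi i = xi j) by exact (leg_nat xi u).
apply redge_lift.
- rw (gf_d0 (arrow u)); rw (redge_d0 (A := H i) (xi i)).
  now rewrite comp_assoc, <- fmap_comp, Exi.
- rw (gf_c0 (arrow u)); rw (redge_c0 (A := H i) (xi i)).
  now rewrite comp_assoc, Exi.
Qed.

Definition restricted_edges : Functor J C.
Proof.
refine {| fobj := fun j => rA1 (A := H j) (xi j);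
          fmap := fun i j u => proj1_sig (rmap_exists u) |}.
- intros i; destruct (rmap_exists (idm i)) as [f [Ed [Ec El]]]; simpl.
  apply redge_unique; rewrite comp_id_r; auto.
  rewrite El; unfold arrow; rewrite fmap_id; apply comp_id_l.
- intros i j k v u.
  destruct (rmap_exists (v · u)) as [f [Ed [Ec El]]],
    (rmap_exists v) as [g [Ed1 [Ec1 El1]]], (rmap_exists u) as [h [Ed2 [Ec2 El2]]]; simpl.
  apply redge_unique; rewrite comp_assoc.
  + now rewrite Ed, Ed1, Ed2.
  + now rewrite Ec, Ec1, Ec2.
  + rewrite El, El1, <- comp_assoc, El2, comp_assoc.
    unfold arrow; now rewrite fmap_comp.
Defined.

Lemma restricted_edges_map (i j : J) (u : Hom i j) :
  rd0 (xi j) · fmap restricted_edges u = rd0 (xi i) /\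
  rc0 (xi j) · fmap restricted_edges u = rc0 (xi i) /\
  redge (xi j) · fmap restricted_edges u = gf1 (arrow u) · redge (xi i).
Proof. exact (proj2_sig (rmap_exists u)). Qed.

End Restriction.

(** The edges of the lifting are the wide pullback, over [T X x X], of the
    restrictions to [X] of the edges of the graphs [H j].  The map to
    [T X x X] is part of the wide pullback, so the ends are determined even if
    [J] is empty. *)
Lemma Gph_topological (C : Category) (PB : Pullbacks C) (T : Monad C) (J : Category) :
  has_binary_products C -> has_wide_pullbacks J C -> topological J (Gph_ob T).
Proof.
intros prods wide H X xi.
destruct (prods (T X) X) as [TXX [p1 [p2 hp]]].
assert (hpair : exists pair : forall W : C, Hom W (T X) -> Hom W X -> Hom W TXX,
          forall W a b, p1 · pair W a b = a /\ p2 · pair W a b = b).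
{ refine (choice (fun W => choice (fun a =>
    choice (R := fun b u => p1 · u = a /\ p2 · u = b) (fun b => _)))).
  destruct (hp W a b) as [u [Eu _]]; now exists u. }
destruct hpair as [pair hpair].
assert (pair1 : forall W a b, p1 · pair W a b = a) by (intros; apply hpair).
assert (pair2 : forall W a b, p2 · pair W a b = b) by (intros; apply hpair).
assert (pair_unique : forall W (u v : Hom W TXX),
          p1 · u = p1 · v -> p2 · u = p2 · v -> u = v).
{ intros W u v E1 E2; destruct (hp W (p1 · u) (p2 · u)) as [w [_ U]].
  rewrite <- (U u), <- (U v); auto. }
pose (ends j := pair _ (rd0 PB (A := H j) (xi j)) (rc0 PB (A := H j) (xi j))).
assert (ends_nat : forall (i j : J) (u : Hom i j),
          ends j · fmap (restricted_edges PB xi) u = ends i).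
{ intros i j u; destruct (restricted_edges_map PB xi u) as [Ed [Ec _]].
  apply pair_unique; unfold ends; rewrite comp_assoc.
  - now rewrite !pair1.
  - now rewrite !pair2. }
destruct (wide (restricted_edges PB xi) TXX
            (Build_Cocone (H := restricted_edges PB xi) (coleg := ends) ends_nat))
  as [E [pi [p [pi_p univ]]]].
simpl in pi_p, univ.
assert (pi_d : forall j, rd0 PB (A := H j) (xi j) · pi j = p1 · p).
{ intros j; rewrite <- (pi_p j); unfold ends; now rewrite comp_assoc, pair1. }
assert (pi_c : forall j, rc0 PB (A := H j) (xi j) · pi j = p2 · p).
{ intros j; rewrite <- (pi_p j); unfold ends; now rewrite comp_assoc, pair2. }
pose (Y := {| A0 := X; A1 := E; d0 := p1 · p; c0 := p2 · p |} : graph T).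
assert (leg_d : forall j, d0 (H j) · (redge PB (A := H j) (xi j) · pi j)
                          = fmap T (xi j) · (p1 · p)).
{ intros j; rewrite <- (pi_d j), !comp_assoc; f_equal; apply redge_d0. }
assert (leg_c : forall j, c0 (H j) · (redge PB (A := H j) (xi j) · pi j)
                          = xi j · (p2 · p)).
{ intros j; rewrite <- (pi_c j), !comp_assoc; f_equal; apply redge_c0. }
pose (leg_hom j := @Build_graph_hom C T Y (H j) (xi j) _ (leg_d j) (leg_c j)).
assert (leg_hom_nat : forall (i j : J) (u : Hom i j),
          graph_comp (fmap H u) (leg_hom i) = leg_hom j).
{ intros i j u; apply graph_hom_eq; simpl.
  - exact (leg_nat xi u).
  - destruct (restricted_edges_map PB xi u) as [_ [_ El]].
    rewrite <- (leg_nat pi u), !comp_assoc; f_equal; symmetry; exact El. }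
pose (alpha := @Build_Cone J (Gph T) H Y leg_hom leg_hom_nat).
exists Y, alpha; split; [now exists eq_refl|].
intros B beta g Eg; simpl in g, Eg.
pose (b j := beta j : graph_hom B (H j)).
(* A cone of graphs over [g] is, on edges, a cone to the restricted edges whose
   map to [T X x X] pairs the images of the two ends under [g]. *)
assert (lifts : forall j, {u : Hom (A1 B) (restricted_edges PB xi j) |
    rd0 PB (xi j) · u = fmap T g · d0 B /\ rc0 PB (xi j) · u = g · c0 B /\
    redge PB (xi j) · u = gf1 (b j)}).
{ intros j; apply redge_lift.
  - rewrite comp_assoc, <- fmap_comp, (Eg j); apply gf_d0.
  - rewrite comp_assoc, (Eg j); apply gf_c0. }
assert (lifts_nat : forall (i j : J) (u : Hom i j),
  fmap (restricted_edges PB xi) u · proj1_sig (lifts i) = proj1_sig (lifts j)).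
{ intros i j u; destruct (lifts i) as [f [Ed [Ec El]]], (lifts j) as [f' [Ed' [Ec' El']]].
  destruct (restricted_edges_map PB xi u) as [Fd [Fc Fl]].
  simpl proj1_sig; apply redge_unique.
  - exact (eq_trans (whisker Fd f) (eq_trans Ed (eq_sym Ed'))).
  - exact (eq_trans (whisker Fc f) (eq_trans Ec (eq_sym Ec'))).
  - refine (eq_trans (whisker Fl f) (eq_trans _ (eq_sym El'))).
    rewrite <- comp_assoc, El.
    exact (f_equal (fun k : graph_hom B (H j) => gf1 k) (leg_nat beta u)). }
pose (gamma := @Build_Cone J C (restricted_edges PB xi) (A1 B) _ lifts_nat).
destruct (univ (A1 B) gamma (pair _ (fmap T g · d0 B) (g · c0 B))) as [f [[Ef Ep] Uf]].
{ intros j; simpl; destruct (lifts j) as [u [Ed [Ec El]]]; simpl; unfold ends.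
  apply pair_unique; rewrite comp_assoc, ?pair1, ?pair2; assumption. }
simpl in Ef.
unshelve refine (let F : graph_hom B Y := @Build_graph_hom C T B Y g f _ _ in _).
{ simpl; now rewrite <- comp_assoc, <- Ep, pair1. }
{ simpl; now rewrite <- comp_assoc, <- Ep, pair2. }
exists F; split; [split; [intros j; apply graph_hom_eq|reflexivity]|].
- apply Eg.
- simpl; rewrite <- comp_assoc, <- Ef.
  exact (proj2 (proj2 (proj2_sig (lifts j)))).
- intros F' [EF' PF']; simpl in PF'; apply graph_hom_eq; [now symmetry|].
  simpl; apply Uf; split.
  + intros j; destruct (lifts j) as [u [Ed [Ec El]]] eqn:Ej; simpl; rewrite Ej; simpl.
    apply redge_unique; rewrite comp_assoc.
    * rewrite Ed, pi_d, <- PF'; symmetry; apply (gf_d0 F').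
    * rewrite Ec, pi_c, <- PF'; symmetry; apply (gf_c0 F').
    * rewrite El; symmetry.
      exact (f_equal (fun k : graph_hom B (H j) => gf1 k) (EF' j)).
  + apply pair_unique; rewrite ?pair1, ?pair2, comp_assoc, <- PF'; symmetry.
    * apply (gf_d0 F').
    * apply (gf_c0 F').
Qed.

(** * Cartesian cones of graphs, seen on edges *)

Section CartesianGraphCones.
Variables (C : Category) (T : Monad C) (J : Category).
Variables (H : Functor J (Gph T)) (Y : graph T) (alpha : Cone H (Y : Gph T)).
Hypothesis cart : is_cartesian (Gph_ob T) alpha.

Let al (j : J) : graph_hom Y (H j) := alpha j.

(** The maps [d], [c] and [l j] amount to a graph with edges [W] on the vertices
    of [Y] and a cone from it lying over the same vertex maps as [alpha]; the
    comparison morphism over the identity is the required map. *)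
Lemma cartesian_factor (W : C) (d : Hom W (T (A0 Y))) (c : Hom W (A0 Y))
  (l : forall j, Hom W (A1 (H j))) :
  (forall j, d0 (H j) · l j = fmap T (gf0 (al j)) · d) ->
  (forall j, c0 (H j) · l j = gf0 (al j) · c) ->
  (forall (i j : J) (u : Hom i j), gf1 (fmap H u : graph_hom (H i) (H j)) · l i = l j) ->
  exists f : Hom W (A1 Y),
    d0 Y · f = d /\ c0 Y · f = c /\ forall j, gf1 (al j) · f = l j.
Proof.
intros Ed Ec nat.
pose (B := {| A0 := A0 Y; A1 := W; d0 := d; c0 := c |} : graph T).
pose (b j := @Build_graph_hom C T B (H j) (gf0 (al j)) (l j) (Ed j) (Ec j)).
assert (b_nat : forall (i j : J) (u : Hom i j), graph_comp (fmap H u) (b i) = b j).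
{ intros i j u; apply graph_hom_eq; simpl; [|apply nat].
  exact (f_equal (fun k : graph_hom Y (H j) => gf0 k) (leg_nat alpha u)). }
destruct (@cart B (@Build_Cone J (Gph T) H B b b_nat) (idm (A0 Y)))
  as [f [[Ef Pf] _]].
{ intros j; apply comp_id_r. }
simpl in f, Pf, Ef; exists (gf1 f); split; [|split].
- refine (eq_trans (gf_d0 f) _); rewrite Pf, fmap_id; apply comp_id_l.
- refine (eq_trans (gf_c0 f) _); rewrite Pf; apply comp_id_l.
- intros j; exact (f_equal (fun k : graph_hom B (H j) => gf1 k) (Ef j)).
Qed.

(** Both [u] and [v] are the edge part of a graph morphism over the identity,
    from the graph with edges [W] and their common ends; both compare the same
    cones. *)
Lemma cartesian_jointly_monic (W : C) (u v : Hom W (A1 Y)) :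
  d0 Y · u = d0 Y · v -> c0 Y · u = c0 Y · v ->
  (forall j, gf1 (al j) · u = gf1 (al j) · v) -> u = v.
Proof.
intros Ed Ec El.
pose (B := {| A0 := A0 Y; A1 := W; d0 := d0 Y · u; c0 := c0 Y · u |} : graph T).
assert (hom : forall w : Hom W (A1 Y), d0 Y · w = d0 B -> c0 Y · w = c0 B ->
          exists h : graph_hom B Y, gf0 h = idm (A0 Y) /\ gf1 h = w).
{ intros w Edw Ecw.
  unshelve eexists (@Build_graph_hom C T B Y (idm (A0 Y)) w _ _); [| |now split].
  - now rewrite fmap_id, comp_id_l.
  - now rewrite comp_id_l. }
destruct (hom u eq_refl eq_refl) as [fu [Pu Eu]].
destruct (hom v (eq_sym Ed) (eq_sym Ec)) as [fv [Pv Ev]].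
assert (b_nat : forall (i j : J) (w : Hom i j),
  graph_comp (fmap H w) (graph_comp (al i) fu) = graph_comp (al j) fu).
{ intros i j w.
  refine (eq_trans (comp_assoc (c := Gph T) (fmap H w) (alpha i) fu) _).
  exact (f_equal (fun k => graph_comp k fu) (leg_nat alpha w)). }
destruct (@cart B (@Build_Cone J (Gph T) H B (fun j => graph_comp (al j) fu) b_nat)
            (idm (A0 Y))) as [f [_ Uf]].
{ intros j; simpl; now rewrite Pu. }
rewrite <- Eu, <- Ev; f_equal; transitivity f; [symmetry|]; apply Uf; split; auto.
intros j; apply graph_hom_eq; simpl.
- now rewrite Pu, Pv.
- rewrite Eu, Ev; symmetry; apply El.
Qed.

End CartesianGraphCones.

(** * The links of the chain lift cartesian cones *)

Section PointedGraphs.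
Variables (C : Category) (T : Monad C) (J : Category).

(** The point is induced by the points of the [H j], with ends [eta] and the
    identity, so that the laws of a pointed graph are part of its
    construction. *)
Lemma PGph_lifts_cartesian : lifts_cartesian J (Gph_ob T) (PGph_to_Gph T).
Proof.
intros H Y alpha cart.
pose (al j := alpha j : graph_hom Y (pg (H j))).
destruct (@cartesian_factor C T J _ Y alpha cart (A0 Y) (eta T (A0 Y)) (idm (A0 Y))
            (fun j => pt (H j) · gf0 (al j))) as [i [i_d [i_c i_l]]].
{ intros j; rw (pt_d0 (H j)); apply eta_nat. }
{ intros j; rw (pt_c0 (H j)); now rewrite comp_id_l, comp_id_r. }
{ intros j k u; rw (pf_pt (fmap H u : pgraph_hom (H j) (H k))); f_equal.
  exact (f_equal (fun h : graph_hom Y (H k) => gf0 h) (leg_nat alpha u)). }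
pose (Y' := {| pg := Y; pt := i; pt_d0 := i_d; pt_c0 := i_c |} : pgraph T).
pose (alpha' j := @Build_pgraph_hom C T Y' (H j) (al j) (i_l j)).
assert (nat : forall (j k : J) (u : Hom j k),
          pgraph_comp (fmap H u) (alpha' j) = alpha' k).
{ intros j k u; apply pgraph_hom_eq; exact (leg_nat alpha u). }
exists Y', (@Build_Cone J (PGph T) H Y' alpha' nat).
split; [now exists eq_refl|].
intros B beta g Eg.
destruct (cart (pg B) (fmap_cone (PGph_to_Gph T) beta) g Eg) as [f [[Ef Pf] Uf]].
simpl in B, g, f, Pf.
assert (Ef1 : forall j, gf1 (al j) · gf1 f = gf1 (beta j : pgraph_hom B (H j)))
  by (intros j; exact (f_equal (fun h : graph_hom B (H j) => gf1 h) (Ef j))).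
assert (f_pt : gf1 f · pt B = i · gf0 f).
{ apply (cartesian_jointly_monic cart).
  - rw (gf_d0 f); rw (pt_d0 B); rw i_d; symmetry; apply eta_nat.
  - rw (gf_c0 f); rw (pt_c0 B); rw i_c; now rewrite comp_id_l, comp_id_r.
  - intros j; fold (al j); rw (Ef1 j); rw (pf_pt (beta j : pgraph_hom B (H j))).
    rw (i_l j); f_equal; rewrite Pf; symmetry; apply Eg. }
exists (@Build_pgraph_hom C T B Y' f f_pt); split; [split|].
- intros j; apply pgraph_hom_eq, Ef.
- exact Pf.
- intros f' [Ef' Pf']; apply pgraph_hom_eq, Uf; split; [|exact Pf'].
  intros j; exact (f_equal (fun h : pgraph_hom B (H j) => pf h) (Ef' j)).
Qed.

End PointedGraphs.

Section TCategoryCones.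
Variables (C : Category) (PB : Pullbacks C) (T : Monad C) (J : Category).

Lemma f2_i1 (A B : pgraph T) (f : pgraph_hom A B) :
  f2 PB f · i1 PB A = i1 PB B · gf1 f.
Proof.
apply A2_unique.
- rw (d1_f2 PB f); rw (d1_i1 PB A); rw (d1_i1 PB B).
  rw (gf_d0 f); rewrite !comp_assoc, <- !fmap_comp; now rewrite pf_pt.
- rw (c1_f2 PB f); rw (c1_i1 PB A); rw (c1_i1 PB B).
  now rewrite comp_id_l, comp_id_r.
Qed.

Lemma f2_i2 (A B : pgraph T) (f : pgraph_hom A B) :
  f2 PB f · i2 PB A = i2 PB B · gf1 f.
Proof.
apply A2_unique.
- rw (d1_f2 PB f); rw (d1_i2 PB A); rw (d1_i2 PB B); symmetry; apply eta_nat.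
- rw (c1_f2 PB f); rw (c1_i2 PB A); rw (c1_i2 PB B).
  rw (pf_pt f); now rewrite gf_c0.
Qed.

Lemma f3_exists (A B : graph T) (f : graph_hom A B) :
  exists f3 : Hom (A3 PB A) (A3 PB B),
    d2 PB B · f3 = fmap T (f2 PB f) · d2 PB A /\ c2 PB B · f3 = f2 PB f · c2 PB A.
Proof.
assert (E : fmap T (c1 PB B) · (fmap T (f2 PB f) · d2 PB A)
            = d1 PB B · (f2 PB f · c2 PB A)).
{ rewrite comp_assoc, <- fmap_comp, c1_f2, fmap_comp; rw (A3_comm PB A).
  now rw (d1_f2 PB f). }
exists (pb_lift (A3_pb PB B) E); split.
- exact (pb_lift_fst (A3_pb PB B) E).
- exact (pb_lift_snd (A3_pb PB B) E).
Qed.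

(** Associativity of [mA] can be tested after any graph morphism to a
    T-category that respects the multiplications: on composable triples, such a
    morphism commutes with [m1] and [m2]. *)
Lemma assoc_transport (A : graph T) (B : tcat PB T) (f : graph_hom A B)
  (mA : Hom (A2 PB A) (A1 A))
  (dom : d0 A · mA = mu T (A0 A) · fmap T (d0 A) · d1 PB A)
  (cod : c0 A · mA = c0 A · c1 PB A) :
  gf1 f · mA = m B · f2 PB f ->
  gf1 f · (mA · m1 cod) = gf1 f · (mA · m2 dom).
Proof.
intros E.
destruct (f3_exists f) as [f3 [d2_f3 c2_f3]].
assert (E1 : f2 PB f · m1 cod = m1 (m_cod B) · f3).
{ apply A2_unique.
  - rw (d1_f2 PB f); rw (d1_m1 cod); rw (d1_m1 (m_cod B)); rw d2_f3.
    now rewrite !comp_assoc, <- !fmap_comp, E.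
  - rw (c1_f2 PB f); rw (c1_m1 cod); rw (c1_m1 (m_cod B)); rw c2_f3.
    now rw (c1_f2 PB f). }
assert (E2 : f2 PB f · m2 dom = m2 (m_dom B) · f3).
{ apply A2_unique.
  - rw (d1_f2 PB f); rw (d1_m2 dom); rw (d1_m2 (m_dom B)); rw d2_f3.
    rewrite (comp_assoc (fmap T (d1 PB B))), <- fmap_comp, d1_f2, fmap_comp; rassoc.
    now rw (mu_nat T (gf1 f)).
  - rw (c1_f2 PB f); rw (c1_m2 dom); rw (c1_m2 (m_dom B)); rw c2_f3.
    now rw E. }
rw E; rw E1; rw E; rw E2; rewrite !comp_assoc; f_equal; apply m_assoc.
Qed.

(** The multiplication is induced from the graph with edges [A2] and the ends of
    composites.  That graph is not pointed, so the universal property is needed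
    for graphs; this is why cartesianness is first moved down to them. *)
Lemma Cat_lifts_cartesian :
  preserves_cartesian J (PGph_ob T) (Gph_ob T) (PGph_to_Gph T) ->
  lifts_cartesian J (PGph_ob T) (Cat_to_PGph PB T).
Proof.
intros pres H Y alpha cart.
pose proof (pres _ _ _ cart) as cartG.
pose (al j := alpha j : pgraph_hom Y (H j)).
destruct (@cartesian_factor C T J _ Y _ cartG (A2 PB Y)
            (mu T (A0 Y) · fmap T (d0 Y) · d1 PB Y) (c0 Y · c1 PB Y)
            (fun j => m (H j) · f2 PB (al j))) as [mY [mY_d [mY_c mY_l]]].
{ intros j; simpl; rw (m_dom (H j)); rw (d1_f2 PB (al j)).
  rewrite (comp_assoc (fmap T (d0 (H j)))), <- fmap_comp, gf_d0, fmap_comp; rassoc.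
  now rw (mu_nat T (gf0 (al j))). }
{ intros j; simpl; rw (m_cod (H j)); rw (c1_f2 PB (al j)); now rw (gf_c0 (al j)). }
{ intros j k u; simpl; rw (tf_m (fmap H u : tfunctor (H j) (H k))).
  rewrite <- f2_comp; do 2 f_equal.
  exact (f_equal (fun h : pgraph_hom Y (H k) => pf h) (leg_nat alpha u)). }
change (forall j, gf1 (al j) · mY = m (H j) · f2 PB (al j)) in mY_l.
assert (mY_i1 : mY · i1 PB Y = idm (A1 Y)).
{ apply (cartesian_jointly_monic cartG); rewrite ?comp_id_r.
  - rw mY_d; rw (d1_i1 PB Y).
    rewrite (comp_assoc (fmap T (d0 Y))), <- fmap_comp, pt_d0.
    rw (monad_id_l T (A0 Y)); apply comp_id_l.
  - rw mY_c; rw (c1_i1 PB Y); apply comp_id_r.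
  - intros j; change (gf1 (al j) · (mY · i1 PB Y) = gf1 (al j) · idm (A1 Y)).
    rewrite comp_id_r.
    rw (mY_l j); rw (f2_i1 (al j)); rw (m_i1 (H j)); apply comp_id_l. }
assert (mY_i2 : mY · i2 PB Y = idm (A1 Y)).
{ apply (cartesian_jointly_monic cartG); rewrite ?comp_id_r.
  - rw mY_d; rw (d1_i2 PB Y); rewrite <- eta_nat.
    rw (monad_id_r T (A0 Y)); apply comp_id_l.
  - rw mY_c; rw (c1_i2 PB Y); rw (pt_c0 Y); apply comp_id_l.
  - intros j; change (gf1 (al j) · (mY · i2 PB Y) = gf1 (al j) · idm (A1 Y)).
    rewrite comp_id_r.
    rw (mY_l j); rw (f2_i2 (al j)); rw (m_i2 (H j)); apply comp_id_l. }
assert (mY_assoc : mY · m1 mY_c = mY · m2 mY_d).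
{ apply (cartesian_jointly_monic cartG).
  - rw mY_d; rw (d1_m1 mY_c); rw mY_d; rw (d1_m2 mY_d).
    rewrite (comp_assoc (fmap T (d0 Y)) (fmap T mY)), <- fmap_comp, mY_d, !fmap_comp.
    rassoc; rw (monad_assoc T (A0 Y)); now rw (mu_nat T (d0 Y)).
  - rw mY_c; rw (c1_m1 mY_c); rw mY_c; rw (c1_m2 mY_d); now rw mY_c.
  - intros j; exact (assoc_transport mY_d mY_c (mY_l j)). }
pose (Y' := {| tc_pg := Y; m := mY; m_dom := mY_d; m_cod := mY_c;
               m_i1 := mY_i1; m_i2 := mY_i2; m_assoc := mY_assoc |} : tcat PB T).
pose (alpha' j := @Build_tfunctor C PB T Y' (H j) (al j) (mY_l j)).
assert (nat : forall (j k : J) (u : Hom j k),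
          tfunctor_comp (fmap H u) (alpha' j) = alpha' k).
{ intros j k u; apply tfunctor_eq; exact (leg_nat alpha u). }
exists Y', (@Build_Cone J (Cat PB T) H Y' alpha' nat).
split; [now exists eq_refl|].
intros B beta g Eg.
destruct (cart (tc_pg B) (fmap_cone (Cat_to_PGph PB T) beta) g Eg) as [f [[Ef Pf] Uf]].
simpl in B, g, f, Pf.
pose (b j := beta j : tfunctor B (H j)).
assert (Efb : forall j, graph_comp (al j) f = b j)
  by (intros j; exact (f_equal (fun h : pgraph_hom B (H j) => pf h) (Ef j))).
assert (f_m : gf1 f · m B = mY · f2 PB f).
{ apply (cartesian_jointly_monic cartG).
  - rw (gf_d0 f); rw (m_dom B); rw mY_d; rw (d1_f2 PB f).
    rewrite (comp_assoc (fmap T (d0 Y))), <- fmap_comp, gf_d0, fmap_comp; rassoc.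
    now rw (mu_nat T (gf0 f)).
  - rw (gf_c0 f); rw (m_cod B); rw mY_c; rw (c1_f2 PB f); now rw (gf_c0 f).
  - intros j; change (gf1 (al j) · (gf1 f · m B) = gf1 (al j) · (mY · f2 PB f)).
    rw (mY_l j); rewrite <- f2_comp, Efb, <- tf_m, comp_assoc, <- Efb; reflexivity. }
exists (@Build_tfunctor C PB T B Y' f f_m); split; [split|].
- intros j; apply tfunctor_eq, Ef.
- exact Pf.
- intros f' [Ef' Pf']; apply tfunctor_eq, Uf; split; [|exact Pf'].
  intros j; exact (f_equal (fun h : tfunctor B (H j) => tf h) (Ef' j)).
Qed.

Lemma Ord_lifts_cartesian :
  preserves_cartesian J (PGph_ob T) (Gph_ob T) (PGph_to_Gph T) ->
  preserves_cartesian J (Cat_ob PB T) (PGph_ob T) (Cat_to_PGph PB T) ->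
  lifts_cartesian J (Cat_ob PB T) (Ord_to_Cat PB T).
Proof.
intros presP presC H Y alpha cart.
pose proof (presP _ _ _ (presC _ _ _ cart)) as cartG.
pose (al j := alpha j : tfunctor Y (proj1_sig (H j))).
assert (ord : is_ordered Y).
{ intros W u v Ed Ec; apply (cartesian_jointly_monic cartG); auto.
  intros j; change (gf1 (al j) · u = gf1 (al j) · v).
  apply (proj2_sig (H j)).
  - rw (gf_d0 (al j)); rw (gf_d0 (al j)); now rewrite Ed.
  - rw (gf_c0 (al j)); rw (gf_c0 (al j)); now rewrite Ec. }
pose (Y' := exist _ Y ord : Ord PB T).
exists Y', (@Build_Cone J (Ord PB T) H Y' al (fun i j u => leg_nat alpha u)).
split; [now exists eq_refl|].
intros B beta g Eg; exact (cart (proj1_sig B) (fmap_cone (Ord_to_Cat PB T) beta) g Eg).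
Qed.

End TCategoryCones.

(** * Discrete T-categories *)

Section Discrete.
Variables (C : Category) (PB : Pullbacks C) (T : Monad C) (X : C).

Definition discrete_graph : graph T :=
  {| A0 := X; A1 := X; d0 := eta T X; c0 := idm X |}.

Definition discrete_pgraph : pgraph T :=
  {| pg := discrete_graph; pt := idm X : Hom (A0 discrete_graph) (A1 discrete_graph);
     pt_d0 := comp_id_r (eta T X); pt_c0 := comp_id_r (idm X) |}.

Definition discrete_m : Hom (A2 PB discrete_pgraph) (A1 discrete_pgraph) :=
  c1 PB discrete_graph.

(** Since [c0] is the identity, the pullback [A2] is [X], through [c1]. *)
Lemma discrete_d1 : d1 PB discrete_graph = eta T X · c1 PB discrete_graph.
Proof.
pose proof (A2_comm PB discrete_graph) as E; simpl in E.
now rewrite fmap_id, comp_id_l in E.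
Qed.

Lemma discrete_m_dom :
  d0 discrete_pgraph · discrete_m =
  mu T (A0 discrete_pgraph) · fmap T (d0 discrete_pgraph) · d1 PB discrete_pgraph.
Proof. simpl; rewrite monad_id_l, comp_id_l; symmetry; apply discrete_d1. Qed.

Lemma discrete_m_assoc :
  discrete_m · m1 (eq_refl : c0 discrete_pgraph · discrete_m
                             = c0 discrete_pgraph · c1 PB discrete_pgraph)
  = discrete_m · m2 discrete_m_dom.
Proof.
refine (eq_trans (c1_m1 (A := discrete_graph) (m := discrete_m) _) _).
symmetry; exact (c1_m2 (A := discrete_graph) discrete_m_dom).
Qed.

Definition discrete_tcat : tcat PB T :=
  {| tc_pg := discrete_pgraph; m := discrete_m; m_dom := discrete_m_dom;
     m_cod := eq_refl; m_i1 := c1_i1 PB discrete_pgraph;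
     m_i2 := eq_trans (c1_i2 PB discrete_pgraph) (comp_id_l _);
     m_assoc := discrete_m_assoc |}.

Lemma discrete_ordered : is_ordered discrete_tcat.
Proof. intros W u v _; simpl; now rewrite !comp_id_l. Qed.

Lemma discrete_extend (B : pgraph T) (g : Hom X (A0 B)) :
  exists! f : pgraph_hom discrete_pgraph B, gf0 f = g.
Proof.
unshelve refine (let f : graph_hom discrete_pgraph B :=
  @Build_graph_hom C T discrete_pgraph B g (pt B · g) _ _ in _).
{ simpl; rw (pt_d0 B); apply eta_nat. }
{ simpl; rw (pt_c0 B); now rewrite comp_id_l, comp_id_r. }
exists (@Build_pgraph_hom C T discrete_pgraph B f (comp_id_r (pt B · g))).
split; [reflexivity|].
intros f' <-; apply pgraph_hom_eq, graph_hom_eq; [reflexivity|]; simpl.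
exact (eq_trans (eq_sym (pf_pt f')) (comp_id_r _)).
Qed.

(** Compatibility with [m] is automatic: each composable pair of the discrete
    graph is sent to a pair of the form [i2], and [m · i2 = 1]. *)
Lemma discrete_functorial (B : tcat PB T) (f : pgraph_hom discrete_pgraph B) :
  gf1 f · discrete_m = m B · f2 PB f.
Proof.
assert (Ef : gf1 f = pt B · gf0 f) by exact (eq_trans (eq_sym (comp_id_r _)) (pf_pt f)).
(* A pair in [A2] is [(eta x, x)] for a vertex [x], and its image is the unit
   pair [i2] at the image of [x]. *)
assert (E : f2 PB f = i2 PB B · (gf1 f · c1 PB discrete_graph)).
{ apply A2_unique.
  - rw (d1_f2 PB f); rw (d1_i2 PB B).
    refine (eq_trans (f_equal (comp (fmap T (gf1 f))) discrete_d1) _).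
    refine (eq_trans (comp_assoc _ _ _) (eq_sym _)).
    exact (whisker (eta_nat T (gf1 f)) (c1 PB discrete_graph)).
  - rw (c1_f2 PB f); rw (c1_i2 PB B); rw (gf_c0 f); rewrite Ef; rassoc; simpl.
    now rewrite comp_id_l. }
rewrite E; rw (m_i2 B); now rewrite comp_id_l.
Qed.

End Discrete.

(** * The chain *)

Section Chain.
Variables (C : Category) (PB : Pullbacks C) (T : Monad C).

Section Topological.
Variable J : Category.
Hypothesis topG : topological J (Gph_ob T).

Lemma PGph_topological : topological J (PGph_ob T).
Proof. exact (topological_comp topG (@PGph_lifts_cartesian C T J)). Qed.

Lemma PGph_to_Gph_cartesian :
  preserves_cartesian J (PGph_ob T) (Gph_ob T) (PGph_to_Gph T).
Proof. exact (preserves_cartesian_comp topG (@PGph_lifts_cartesian C T J)). Qed.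

Lemma Cat_topological : topological J (Cat_ob PB T).
Proof.
exact (topological_comp PGph_topological (Cat_lifts_cartesian PGph_to_Gph_cartesian)).
Qed.

Lemma Cat_to_PGph_cartesian :
  preserves_cartesian J (Cat_ob PB T) (PGph_ob T) (Cat_to_PGph PB T).
Proof.
exact (preserves_cartesian_comp PGph_topological
         (Cat_lifts_cartesian PGph_to_Gph_cartesian)).
Qed.

Lemma Ord_topological : topological J (Ord_ob PB T).
Proof.
exact (topological_comp Cat_topological
         (Ord_lifts_cartesian PGph_to_Gph_cartesian Cat_to_PGph_cartesian)).
Qed.

Lemma Ord_to_Cat_cartesian :
  preserves_cartesian J (Ord_ob PB T) (Cat_ob PB T) (Ord_to_Cat PB T).
Proof.
exact (preserves_cartesian_comp Cat_topological
         (Ord_lifts_cartesian PGph_to_Gph_cartesian Cat_to_PGph_cartesian)).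
Qed.

Lemma chain_topological (k : chain) : topological J (chain_ob PB T k).
Proof.
destruct k; [exact Ord_topological|exact Cat_topological|exact PGph_topological|exact topG].
Qed.

End Topological.

Lemma chain_left_adjoint (k : chain) :
  k <> GPH -> has_left_adjoint_right_inverse (chain_ob PB T k).
Proof.
assert (ext : forall (X : C) (B : tcat PB T) (g : Hom X (A0 B)),
  exists! f : tfunctor (discrete_tcat PB T X) B, gf0 f = g).
{ intros X B g; destruct (discrete_extend g) as [f [Pf Uf]].
  exists (@Build_tfunctor C PB T (discrete_tcat PB T X) B f (discrete_functorial f)).
  split; [exact Pf|].
  intros f' Pf'; apply tfunctor_eq, Uf, Pf'. }
destruct k; intros ne; [| | |now destruct ne]; apply discrete_left_adjoint; intros X.
- exists (exist _ (discrete_tcat PB T X) (@discrete_ordered C PB T X)), eq_refl.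
  intros B g; exact (ext X (proj1_sig B) g).
- exists (discrete_tcat PB T X), eq_refl; intros B g; exact (ext X B g).
- exists (discrete_pgraph T X), eq_refl; intros B g; exact (discrete_extend g).
Qed.

Lemma empty_wide_pullbacks : has_wide_pullbacks empty_category C.
Proof.
intros H B beta; exists B, (empty_cone H B), (idm B); split; [intros []|].
intros D gamma q _; exists q; split; [split; [intros []|now rewrite comp_id_l]|].
intros f [_ ->]; apply comp_id_l.
Qed.

End Chain.

(** * Eilenberg-Moore algebras *)

Section Algebras.
Variables (C : Category) (PB : Pullbacks C) (T : Monad C) (J : Category).

Definition Alg_car : Functor (Alg T) C :=
  {| fobj := fun A : Alg T => car A;
     fmap := fun (A B : Alg T) (f : Hom A B) => af f;
     fmap_id := fun A => eq_refl;
     fmap_comp := fun A B D g f => eq_refl |}.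

(** The underlying-object functor creates limits: the actions composed with the
    legs form a cone on [T L], which induces the action on [L]. *)
Lemma Alg_limit (H : Functor J (Alg T)) (L : C) (pi : Cone (compF Alg_car H) L) :
  is_limit pi ->
  exists (X : Alg T) (alpha : Cone H X),
    is_limit alpha /\ is_limit (fmap_cone Alg_car alpha).
Proof.
intros lim.
pose proof (limit_jointly_monic lim) as monic.
pose (p j := pi j : Hom L (car (H j))).
assert (p_nat : forall (i j : J) (u : Hom i j),
          af (fmap H u : algebra_hom (H i) (H j)) · p i = p j)
  by exact (leg_nat pi).
assert (act_nat : forall (i j : J) (u : Hom i j),
   af (fmap H u : algebra_hom (H i) (H j)) · (act (H i) · fmap T (p i))
   = act (H j) · fmap T (p j)).
{ intros i j u; rw (af_act (fmap H u : algebra_hom (H i) (H j))).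
  now rewrite <- fmap_comp, p_nat. }
destruct (lim (T L) (@Build_Cone J C (compF Alg_car H) (T L) _ act_nat)) as [a [Ea _]].
change (forall j, p j · a = act (H j) · fmap T (p j)) in Ea.
assert (a_eta : a · eta T L = idm L).
{ apply monic; intros j; change (p j · (a · eta T L) = p j · idm L).
  rw (Ea j); rewrite <- eta_nat; rw (act_eta (H j)); now rewrite comp_id_l, comp_id_r. }
assert (a_mu : a · fmap T a = a · mu T L).
{ apply monic; intros j; change (p j · (a · fmap T a) = p j · (a · mu T L)).
  rw (Ea j); rw (Ea j); rewrite <- fmap_comp, Ea, fmap_comp, <- mu_nat.
  rw (act_mu (H j)); reflexivity. }
pose (X := {| car := L; act := a; act_eta := a_eta; act_mu := a_mu |} : algebra T).
pose (al j := @Build_algebra_hom C T X (H j) (p j) (Ea j)).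
assert (al_nat : forall (i j : J) (u : Hom i j), algebra_comp (fmap H u) (al i) = al j).
{ intros i j u; apply algebra_hom_eq, p_nat. }
exists X, (@Build_Cone J (Alg T) H X al al_nat); split; [|exact lim].
intros Z gamma.
destruct (lim (car Z) (fmap_cone Alg_car gamma)) as [f [Ef Uf]].
pose (ga j := gamma j : algebra_hom Z (H j)).
change (forall j, p j · f = af (ga j)) in Ef.
assert (f_act : f · act Z = a · fmap T f).
{ apply monic; intros j; change (p j · (f · act Z) = p j · (a · fmap T f)).
  rw (Ef j); rw (Ea j); rewrite <- fmap_comp, Ef; apply (af_act (ga j)). }
exists (@Build_algebra_hom C T Z X f f_act); split.
- intros j; apply algebra_hom_eq, Ef.
- intros f' Ef'; apply algebra_hom_eq; simpl; apply Uf.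
  intros j; exact (f_equal (fun h : algebra_hom Z (H j) => af h) (Ef' j)).
Qed.

(** In the graph of an algebra [d0] is the identity, so the edge part must be
    [T g · d0]; the displayed equation is compatibility with [c0], and naturality
    of [eta] and [mu] gives compatibility with units and multiplications. *)
Lemma hom_to_algebra (B : tcat PB T) (L : algebra T) (g : Hom (A0 B) (car L)) :
  act L · (fmap T g · d0 B) = g · c0 B ->
  exists f : tfunctor B (alg_tcat PB L), gf0 f = g.
Proof.
intros E.
unshelve refine (let f : graph_hom B (alg_graph L) :=
  @Build_graph_hom C T B (alg_graph L) g (fmap T g · d0 B) _ E in _).
{ apply comp_id_l. }
unshelve refine (let fp : pgraph_hom B (alg_pgraph L) :=
  @Build_pgraph_hom C T B (alg_pgraph L) f _ in _).
{ simpl; rw (pt_d0 B); symmetry; apply eta_nat. }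
unshelve eexists (@Build_tfunctor C PB T B (alg_tcat PB L) fp _); [|reflexivity].
simpl; unfold alg_m; rw (m_dom B); pose proof (d1_f2 PB f) as Ed; simpl in Ed.
rw Ed; rewrite fmap_comp; rassoc; now rw (mu_nat T g).
Qed.

Lemma hom_to_algebra_ext (B : tcat PB T) (L : algebra T)
  (f f' : tfunctor B (alg_tcat PB L)) : gf0 f = gf0 f' -> f = f'.
Proof.
intros E; apply tfunctor_eq, pgraph_hom_eq, graph_hom_eq; [exact E|].
pose proof (gf_d0 f) as Ed; pose proof (gf_d0 f') as Ed'; simpl in *.
rewrite comp_id_l in *; congruence.
Qed.

(** The limit provides the morphism of vertices [g]; the equation that makes it a
    T-functor holds after composing with the legs, where it is compatibility of
    the given T-functors with [c0]. *)
Lemma Alg_to_Ord_limit (H : Functor J (Alg T)) (L : Alg T) (alpha : Cone H L) :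
  is_limit (fmap_cone Alg_car alpha) -> is_limit (fmap_cone (Alg_to_Ord PB T) alpha).
Proof.
intros lim B beta.
pose proof (limit_jointly_monic lim) as monic.
pose (al j := alpha j : algebra_hom L (H j)).
pose (b j := beta j : tfunctor (proj1_sig B) (alg_tcat PB (H j))).
assert (b_nat : forall (i j : J) (u : Hom i j),
          af (fmap H u : algebra_hom (H i) (H j)) · gf0 (b i) = gf0 (b j)).
{ intros i j u.
  exact (f_equal (fun h : tfunctor (proj1_sig B) (alg_tcat PB (H j)) => gf0 h)
           (leg_nat beta u)). }
destruct (lim _ (@Build_Cone J C (compF Alg_car H) (A0 (proj1_sig B)) _ b_nat))
  as [g [Eg Ug]].
change (forall j, af (al j) · g = gf0 (b j)) in Eg.
destruct (@hom_to_algebra (proj1_sig B) L g) as [f Pf].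
{ apply monic; intros j.
  change (af (al j) · (act L · (fmap T g · d0 (proj1_sig B)))
          = af (al j) · (g · c0 (proj1_sig B))).
  rw (af_act (al j)); rw (Eg j).
  rewrite (comp_assoc (fmap T (af (al j)))), <- fmap_comp, Eg.
  assert (Ed : gf1 (b j) = fmap T (gf0 (b j)) · d0 (proj1_sig B))
    by exact (eq_trans (eq_sym (comp_id_l _)) (gf_d0 (b j))).
  exact (eq_trans (f_equal (comp (act (H j))) (eq_sym Ed)) (gf_c0 (b j))). }
exists f; split.
- intros j; apply hom_to_algebra_ext.
  exact (eq_trans (f_equal (comp (af (al j))) Pf) (Eg j)).
- intros f' Ef'; apply hom_to_algebra_ext; refine (eq_trans Pf _); apply Ug; intros j.
  exact (f_equal (fun h : tfunctor (proj1_sig B) (alg_tcat PB (H j)) => gf0 h) (Ef' j)).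
Qed.

Hypothesis limC : has_limits J C.

Lemma Alg_has_limits : has_limits J (Alg T).
Proof.
intros H; destruct (limC (compF Alg_car H)) as [L [pi lim]].
destruct (Alg_limit lim) as [X [alpha [la _]]]; now exists X, alpha.
Qed.

Lemma Alg_to_Ord_preserves_limits : preserves_limits J (Alg_to_Ord PB T).
Proof.
intros H X alpha la.
destruct (limC (compF Alg_car H)) as [L [pi lim]].
destruct (Alg_limit lim) as [Y [beta [lb lC]]].
destruct (limit_iso la lb) as [u [v [uv E]]].
apply Alg_to_Ord_limit.
apply (limit_of_iso (beta := fmap_cone Alg_car beta) (fmap_inverse Alg_car uv));
  [|exact lC].
intros j; simpl; rewrite <- E; reflexivity.
Qed.

End Algebras.

Theorem theorem4p9 :
  forall (C : Category) (PB : Pullbacks C) (T : Monad C) (J : Category),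
    (has_binary_products C -> has_wide_pullbacks J C ->
      (forall k : chain,
         topological J (chain_ob PB T k) /\
         has_right_adjoint_right_inverse (chain_ob PB T k) /\
         (k <> GPH -> has_left_adjoint_right_inverse (chain_ob PB T k))) /\
      (has_limits J C ->
         (forall k : chain,
            has_limits J (chain_cat PB T k) /\
            preserves_limits J (chain_ob PB T k)) /\
         preserves_limits J (Ord_to_Cat PB T) /\
         preserves_limits J (Cat_to_PGph PB T) /\
         preserves_limits J (PGph_to_Gph T)) /\
      preserves_cartesian J (Ord_ob PB T) (Cat_ob PB T) (Ord_to_Cat PB T) /\
      preserves_cartesian J (Cat_ob PB T) (PGph_ob T) (Cat_to_PGph PB T) /\
      preserves_cartesian J (PGph_ob T) (Gph_ob T) (PGph_to_Gph T)) /\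
    (has_limits J C ->
       has_limits J (Alg T) /\ preserves_limits J (Alg_to_Ord PB T)).
Proof.
intros C PB T J; split.
- intros prods wide.
  pose proof (Gph_topological PB (T := T) prods wide) as topG.
  pose proof (Gph_topological PB (T := T) prods (@empty_wide_pullbacks C)) as topG0.
  split; [|split; [|split; [|split]]].
  + intros k; split; [|split].
    * now apply chain_topological.
    * now apply topological_right_adjoint, chain_topological.
    * apply chain_left_adjoint.
  + intros limC; split; [|split; [|split]].
    * intros k; pose proof (@chain_topological C PB T J topG k) as top; split.
      -- exact (topological_has_limits top limC).
      -- exact (topological_preserves_limits top limC).
    * apply (preserves_limits_link (Cat_topological (PB := PB) topG)); [|exact limC].
      apply Ord_lifts_cartesian; [apply PGph_to_Gph_cartesian|apply Cat_to_PGph_cartesian];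
        exact topG.
    * apply (preserves_limits_link (PGph_topological topG)); [|exact limC].
      apply Cat_lifts_cartesian, PGph_to_Gph_cartesian, topG.
    * apply (preserves_limits_link topG); [|exact limC].
      apply PGph_lifts_cartesian.
  + now apply Ord_to_Cat_cartesian.
  + now apply Cat_to_PGph_cartesian.
  + now apply PGph_to_Gph_cartesian.
- intros limC; split; [now apply Alg_has_limits|now apply Alg_to_Ord_preserves_limits].
Qed.
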